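(* Let $(\theta_n)_{n\ge0}$ be generated by MLMC-Adagrad as described in the context, with positive deterministic sequences $(\gamma_n)_{n\ge1}$, $(T_n)_{n\ge1}$, $(\varepsilon_n)_{n\ge1}$ and clipping thresholds $(M_n)_{n\ge0}$. Assume: (i) $V:\mathbb{R}^d\to\mathbb{R}$ is differentiable and $\|\nabla V(\theta)-\nabla V(\theta')\|\le L\|\theta-\theta'\|$ for all $\theta,\theta'\in\mathbb{R}^d$; (ii) there is $G>0$ such that $\|H_\theta\|_\infty\le G$ for all $\theta\in\mathbb{R}^d$; (iii) there are constants $c_1,c_2$ such that for all $n\ge 0$, $$\left\|\mathbb{E}[\widehat H^{(n+1)}\mid\mathcal F_n]-h(\theta_n)\right\|\le \frac{c_1G}{T_{n+1}},\qquad \mathbb{E}\left[\|\widehat H^{(n+1)}\|^2\right]\le c_2G^2\log(T_{n+1});$$ (iv) there is a constant $c_3$ such that $\mathbb{E}[\|\widehat H^{(n+1)}\|^3]\le c_3G^3\sqrt{T_{n+1}}$ for all $n\ge0$. Define $\underline\varepsilon_0=\varepsilon_1$ and $\underline\varepsilon_n=\left(\varepsilon_{n+1}^{-2}+\sup_{0\le i\le n-1}M_i^2\right)^{-1/2}$ for $n\ge1$. For $N\ge1$ put $\varpi_N=\sum_{k=0}^N\gamma_{k+1}\underline\varepsilon_k$ and let $R$ be a random variable, independent of the algorithm, with $\mathbb{P}[R=n]=\gamma_{n+1}\underline\varepsilon_n/\varpi_N$ for $n\in\{0,\dots,N\}$. Then for every $N\ge1$, $$\mathbb{E}\left[\|\nabla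 V(\theta_R)\|^2\right]\le\frac2{\varpi_N}\Bigg(\mathbb{E}[V(\theta_0)]-V(\theta^* )+c_1G^2\sum_{n=1}^{N+1}\gamma_n\frac{\varepsilon_n}{T_n}+c_3G^4\sum_{n=1}^{N+1}\gamma_n\frac{\varepsilon_n^3}{n}\sqrt{T_n}+c_2G^2\frac L2\sum_{n=1}^{N+1}\gamma_n^2\varepsilon_n^2\log(T_n)\Bigg).$$
   Context: Setting. $\|\cdot\|$ is the Euclidean norm on $\mathbb{R}^d$. $\theta^*\in\mathbb{R}^d$ is a global minimizer of $V$. For each $\theta\in\mathbb{R}^d$, $H_\theta:\mathbb{X}\to\mathbb{R}^d$ is a measurable function on a measurable space $\mathbb{X}\subseteq\mathbb{R}^q$, $\|H_\theta\|_\infty=\sup_{x\in\mathbb{X}}\|H_\theta(x)\|$, $P_\theta$ is a Markov kernel on $\mathbb{X}$ with invariant probability $\pi_\theta$, and $h(\theta)=\mathbb{E}_{\pi_\theta}[H_\theta(X)]$. Throughout it is assumed that $h(\theta)=\nabla V(\theta)$ for all $\theta$. MLMC estimator. $(K_n)_{n\ge1}$ are i.i.d. geometric, $\mathbb{P}(K_n=k)=2^{-k}$ for $k\ge1$. $\mathcal F_0$ is trivial and $\mathcal F_n=\sigma(K_1,\mathbf X^{(1)},\dots,K_n,\mathbf X^{(n)})$. At step $n\ge0$, given $\mathcal F_n$, $\mathbf X^{(n+1)}=(X_i^{(n+1)})_{i\ge1}$ is a Markov chain with kernel $P_{\theta_n}$, and $K_{n+1}$ is independent of $\mathcal F_n$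 and $\mathbf X^{(n+1)}$. For an integer $p\ge1$ let $H_\theta^{(p)}(\mathbf x)=\frac1p\sum_{i=1}^pH_\theta(x_i)$. With $t_{n+1}=2^{K_{n+1}}$, the MLMC estimator is $$\widehat H^{(n+1)}=H_{\theta_n}(X_1^{(n+1)})+t_{n+1}\left\{H_{\theta_n}^{(t_{n+1})}(\mathbf X^{(n+1)})-H_{\theta_n}^{(t_{n+1}/2)}(\mathbf X^{(n+1)})\right\}\mathbf 1_{t_{n+1}\le T_{n+1}}.$$ MLMC-Adagrad. $\theta_0\in\mathbb{R}^d$ and $\theta_{n+1}=\theta_n-\gamma_{n+1}A_n\widehat H^{(n+1)}$ for $n\ge0$, where $$A_n=\left\{\frac1{\varepsilon_{n+1}^2}I_d+\mathrm{Diag}\left(\frac1{n+1}\sum_{k=0}^n\widetilde{\mathcal H}^{(k)}\right)\right\}^{-1/2},$$ and $\widetilde{\mathcal H}^{(k)}$ is the $d\times d$ diagonal matrix with entries $\widetilde{\mathcal H}^{(k)}_{ii}=\min\{(e_i^\top\widehat H^{(k+1)})^2,M_k^2\}$, $e_i$ being the $i$-th canonical basis vector and $(M_k)_{k\ge0}$ a deterministic user-specified sequence. Note that $A_n$ depends on $\widehat H^{(n+1)}$ and so is not $\mathcal F_n$-measurable in general. *)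

(* Defs.v *)
From mathcomp Require Import all_boot all_order all_algebra.
From mathcomp Require Import all_classical all_reals all_analysis.

Set Implicit Arguments.
Unset Strict Implicit.
Unset Printing Implicit Defensive.

Import Order.TTheory GRing.Theory Num.Theory.
Import numFieldNormedType.Exports.

Local Open Scope classical_set_scope.
Local Open Scope ring_scope.

(* Measurable types are pointed, so a (nonempty) subset of T with the trace
   sigma-algebra is presented as a type E with an embedding into T. *)
Definition measurable_embedding {dE dT : measure_display}
    {E : measurableType dE} {T : measurableType dT} (iota : E -> T) : Prop :=
  injective iota /\
  (measurable : set (set E)) = preimage_set_system setT iota measurable.

(* The norm `|x| of the library on 'cV[R]_d is the sup norm. *)
Definition enorm {R : realType} {d : nat} (x : 'cV[R]_d) : R :=
  Num.sqrt (\sum_i x i 0 ^+ 2).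

Definition grad {R : realType} {d : nat} (V : 'cV[R]_d -> R) (x : 'cV[R]_d) :
  'cV[R]_d := \col_i 'D_(delta_mx i 0) V x.

Definition sup_enorm {R : realType} {d : nat} {E : Type} (f : E -> 'cV[R]_d) :
  \bar R := ereal_sup [set (enorm (f x))%:E | x in setT].

Definition invariant_law {R : realType} {dE : measure_display}
    {E : measurableType dE} (Q : R.-pker E ~> E) (mu : probability E R) : Prop :=
  forall B, measurable B -> (\int[mu]_x Q x B = mu B)%E.

Definition mean_field {R : realType} {d : nat} {dE : measure_display}
    {E : measurableType dE} (H : 'cV[R]_d -> E -> 'cV[R]_d)
    (pi_ : 'cV[R]_d -> probability E R) (theta : 'cV[R]_d) : 'cV[R]_d :=
  \col_i \int[pi_ theta]_x (H theta x i 0).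

Section probability.
Context {R : realType} {dO : measure_display} {Omega : measurableType dO}.
Variable P : probability Omega R.

(* g is a version of the conditional expectation of f given the
   sigma-algebra F. *)
Definition is_cond_exp (F : set (set Omega)) (f g : Omega -> R) : Prop :=
  [/\ P.-integrable setT (EFin \o f),
      P.-integrable setT (EFin \o g),
      forall B, measurable B -> F (g @^-1` B) &
      forall A, F A -> (\int[P]_(w in A) (g w)%:E = \int[P]_(w in A) (f w)%:E)%E].

Definition independent (F G : set (set Omega)) : Prop :=
  forall A B, F A -> G B -> (P (A `&` B) = P A * P B)%E.

(* Product formula for the joint law of (K_1, ..., K_n): it says both that
   P(K_j = k) = 2^-k for k >= 1 and that the K_j are independent. *)
Definition iid_geometric (K : nat -> Omega -> nat) : Prop :=
  forall (n : nat) (k : nat -> nat), (forall j, (1 <= k j)%N) ->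
  P [set w | forall j, (1 <= j <= n)%N -> K j w = k j] =
  (\prod_(1 <= j < n.+1) 2 ^- k j)%:E.

End probability.

(* Indices are those of the usual notation: K n and X n i stand for K_n and
   X_i^(n), and are meaningful for n >= 1 and i >= 1 only. *)
Section filtration.
Context {dO dE : measure_display}.
Context {Omega : measurableType dO} {E : measurableType dE}.
Variables (K : nat -> Omega -> nat) (X : nat -> nat -> Omega -> E).

Definition draws (n : nat) (I : set nat) : set (set Omega) :=
  \bigcup_(i in I) preimage_set_system setT (X n i) measurable.

Definition round (n : nat) : set (set Omega) :=
  preimage_set_system setT (K n) measurable `|` draws n [set i | (1 <= i)%N].

(* F_n = sigma(K_1, X^(1), ..., K_n, X^(n)) *)
Definition history (n : nat) : set (set Omega) :=
  <<s \bigcup_(j in [set j | (1 <= j <= n)%N]) round j >>.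

(* sigma(F_n, X_i^(n+1), i in I) *)
Definition history_draws (n : nat) (I : set nat) : set (set Omega) :=
  <<s history n `|` draws n.+1 I >>.

Definition full_history : set (set Omega) :=
  <<s \bigcup_(j in [set j | (1 <= j)%N]) round j >>.

(* Given F_n, (X_i^(n+1))_(i >= 1) is a Markov chain with the F_n-measurable
   random kernel Q. *)
Definition markov_given_history {R : realType} (P : probability Omega R)
    (Q : Omega -> R.-pker E ~> E) (n : nat) : Prop :=
  forall (i : nat) (B : set E), (1 <= i)%N -> measurable B ->
  is_cond_exp P (history_draws n [set l | (1 <= l <= i)%N])
    (\1_(X n.+1 i.+1 @^-1` B))
    (fun w => fine (Q w (X n.+1 i w) B)).

End filtration.

Section mlmc_adagrad.
Context {R : realType} {d : nat} {E : Type}.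
Variable H : 'cV[R]_d -> E -> 'cV[R]_d.

Definition empirical_mean (theta : 'cV[R]_d) (p : nat) (x : nat -> E) :
  'cV[R]_d := p%:R^-1 *: \sum_(1 <= i < p.+1) H theta (x i).

(* k is the value of K_(n+1) and tau is T_(n+1). *)
Definition mlmc (tau : R) (theta : 'cV[R]_d) (k : nat) (x : nat -> E) :
    'cV[R]_d :=
  let t := (2 ^ k)%N in
  H theta (x 1%N) +
  if t%:R <= tau then
    t%:R *: (empirical_mean theta t x - empirical_mean theta (t %/ 2) x)
  else 0.

Context {Omega : Type}.

(* Hhat n is the estimator \hat H^(n+1), built from K_(n+1) and X^(n+1). *)
Definition Hhat (T : nat -> R) (K : nat -> Omega -> nat)
    (X : nat -> nat -> Omega -> E) (theta : nat -> Omega -> 'cV[R]_d)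
    (n : nat) (w : Omega) : 'cV[R]_d :=
  mlmc (T n.+1) (theta n w) (K n.+1 w) (fun i => X n.+1 i w).

Variables (eps M : nat -> R).

(* Below, Hh k stands for \hat H^(k+1). *)
Definition clipped_squares (Hh : nat -> Omega -> 'cV[R]_d) (k : nat)
    (w : Omega) : 'M[R]_d :=
  diag_mx (\row_i Num.min (Hh k w i 0 ^+ 2) (M k ^+ 2)).

(* S^(-1/2) for a diagonal matrix S with positive diagonal. *)
Definition diag_invsqrt (S : 'M[R]_d) : 'M[R]_d :=
  diag_mx (\row_i (S i i `^ (- 2^-1))).

Definition adagrad_matrix (Hh : nat -> Omega -> 'cV[R]_d) (n : nat)
    (w : Omega) : 'M[R]_d :=
  diag_invsqrt ((eps n.+1 ^- 2)%:M
    + n.+1%:R^-1 *: \sum_(0 <= k < n.+1) clipped_squares Hh k w).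

Definition mlmc_adagrad (gamma T : nat -> R) (K : nat -> Omega -> nat)
    (X : nat -> nat -> Omega -> E) (theta0 : 'cV[R]_d)
    (theta : nat -> Omega -> 'cV[R]_d) : Prop :=
  let Hh := Hhat T K X theta in
  (forall w, theta 0%N w = theta0) /\
  (forall n w, theta n.+1 w =
     theta n w - gamma n.+1 *: (adagrad_matrix Hh n w *m Hh n w)).

(* The squares being nonnegative, 0 is a neutral default for the maximum. *)
Definition eps_low (n : nat) : R :=
  if n is 0%N then eps 1%N else
  (eps n.+1 ^- 2 + \big[Num.max/0]_(0 <= i < n) M i ^+ 2) `^ (- 2^-1).

Definition varpi (gamma : nat -> R) (N : nat) : R :=
  \sum_(0 <= k < N.+1) gamma k.+1 * eps_low k.

End mlmc_adagrad.

(* Main.v *)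
Require Import Defs.
From mathcomp Require Import all_boot all_order all_algebra.
From mathcomp Require Import all_classical all_reals all_analysis.
From mathcomp Require Import measurable_realfun ring lra.

Set Implicit Arguments.
Unset Strict Implicit.
Unset Printing Implicit Defensive.

Import Order.TTheory GRing.Theory Num.Theory.
Import numFieldNormedType.Exports.

Local Open Scope classical_set_scope.
Local Open Scope ring_scope.

(** The objective decreases along the iterates because the step of the
    algorithm is, up to controlled errors, a preconditioned gradient step.
    Write [u] for the estimator at step [n + 1], [a_i] for the diagonal of
    [A_n], and [p_i] for what the diagonal becomes when the clipped square
    of [u] is left out of the accumulated sum while the normalisation [n +
    1] is kept. The point of [p] is that it is known before [u] is drawn. As
    [p_i - a_i <= eps^3 / (n + 1) * |u|^2] ([step_size_predictable]), the
    descent inequality of a function with Lipschitz gradient gives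
    ([descent_step])

      V(theta') <= V(theta) - gamma * sum_i p_i u_i (grad V)_i
                   + gamma * G eps^3 / (n + 1) * |u|^3
                   + L / 2 * gamma^2 eps^2 * |u|^2,

    where the gradient is bounded by [G], being a mean of the fields
    ([enorm_mean_field_le]). In expectation, [u] may be replaced in the
    linear term by its conditional expectation ([cond_exp_pull_out]), which
    is the gradient up to the bias [c1 G / T]; since the clipping bounds
    [p_i] from below by [eps_low], that term is at least [eps_low * E|grad
    V|^2 - G eps * c1 G / T]. The two remaining terms are the second and
    third moments. This is [expected_descent_step]; summing it over the
    steps telescopes, [V] is bounded below by its minimum, and the law of
    the random index turns the weighted sum into the expectation at that
    index ([expectation_random_index]).

    All the random variables of the algorithm are bounded: truncation caps
    the estimator ([coord_mlmc_le]) and [eps] caps the step sizes, so each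
    iterate ranges in a bounded set and every integral above is finite. That
    each iterate depends only on its past is [theta_adapted]; composing with
    the gradient and with [V] preserves measurability since both are
    continuous ([measurable_continuous_comp]). *)

(** * Euclidean geometry *)

Section euclidean.
Context {R : realType} {d : nat}.
Implicit Types (x y u v w : 'cV[R]_d) (c : R).

Lemma enorm_ge0 x : 0 <= enorm x.
Proof. exact: sqrtr_ge0. Qed.

Lemma enorm_sqr x : enorm x ^+ 2 = \sum_i x i 0 ^+ 2.
Proof. by rewrite sqr_sqrtr// sumr_ge0// => i _; rewrite sqr_ge0. Qed.

Lemma coord_le_enorm x i : `|x i 0| <= enorm x.
Proof.
rewrite -(ler_sqr (normr_ge0 _) (enorm_ge0 _)) enorm_sqr real_normK ?num_real//.
by rewrite (bigD1 i)//= lerDl sumr_ge0// => j _; rewrite sqr_ge0.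
Qed.

Lemma enormZ c x : enorm (c *: x) = `|c| * enorm x.
Proof.
apply/eqP; rewrite -(eqrXn2 (n := 2)) ?mulr_ge0 ?enorm_ge0//.
rewrite exprMn !enorm_sqr real_normK ?num_real// mulr_sumr.
by apply/eqP; apply: eq_bigr => i _; rewrite mxE exprMn.
Qed.

Lemma ler_enorm x y : (forall i, `|x i 0| <= `|y i 0|) -> enorm x <= enorm y.
Proof.
move=> xy; rewrite ler_wsqrtr// ler_sum// => i _.
rewrite -real_normK ?num_real// -[leRHS]real_normK ?num_real//.
by rewrite lerXn2r ?nnegrE.
Qed.

Lemma enorm_le_mx_norm x : enorm x <= d%:R * `|x|.
Proof.
rewrite -(ler_sqr (enorm_ge0 _)) ?nnegrE ?mulr_ge0// enorm_sqr.
have xi i : x i 0 ^+ 2 <= `|x| ^+ 2.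
  rewrite -real_normK ?num_real// lerXn2r ?nnegrE//.
  rewrite [leRHS]/Num.Def.normr/= mx_normrE.
  by apply/bigmax_geP; right => /=; exists (i, 0).
rewrite (le_trans (ler_sum _ (fun i _ => xi i)))// sumr_const card_ord.
rewrite -[leLHS]mulr_natl exprMn ler_wpM2r ?sqr_ge0//.
by rewrite -natrX ler_nat; case: (d) => // n; rewrite leq_pmulr.
Qed.

(** Expanding the sum of the squares of [|v| |u_i| - |u| |v_i|] gives
    Cauchy-Schwarz for the absolute values; the weights only enter through
    their common bound. *)
Lemma weighted_cauchy_schwarz w u v c : (forall i, `|w i 0| <= c) ->
  `|\sum_i w i 0 * u i 0 * v i 0| <= c * (enorm u * enorm v).
Proof.
move=> wc.
pose S := \sum_i `|u i 0| * `|v i 0|.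
have S_ge0 : 0 <= S by rewrite sumr_ge0// => i _; rewrite mulr_ge0.
have ScS : S <= enorm u * enorm v.
  have : 0 <= \sum_i (enorm v * `|u i 0| - enorm u * `|v i 0|) ^+ 2.
    by rewrite sumr_ge0// => i _; rewrite sqr_ge0.
  have -> : \sum_i (enorm v * `|u i 0| - enorm u * `|v i 0|) ^+ 2 =
      2 * (enorm u * enorm v) * (enorm u * enorm v - S).
    transitivity (enorm v ^+ 2 * (\sum_i u i 0 ^+ 2)
        + enorm u ^+ 2 * (\sum_i v i 0 ^+ 2) - 2 * (enorm u * enorm v) * S).
      rewrite /S !mulr_sumr -big_split -sumrB/=; apply: eq_bigr => i _.
      rewrite -(real_normK (num_real (u i 0))) -(real_normK (num_real (v i 0))).
      by ring.
    by rewrite -!enorm_sqr; ring.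
  have := mulr_ge0 (enorm_ge0 u) (enorm_ge0 v).
  rewrite le_eqVlt => /predU1P[uv0 _|uv_gt0]; last first.
    by rewrite pmulr_rge0 ?subr_ge0// mulr_gt0.
  rewrite -uv0 /S big1// => i _.
  move/esym/eqP : uv0; rewrite mulf_eq0 => /orP[]/eqP n0.
    have := coord_le_enorm u i; rewrite n0 normr_le0 => /eqP ->.
    by rewrite normr0 mul0r.
  have := coord_le_enorm v i; rewrite n0 normr_le0 => /eqP ->.
  by rewrite normr0 mulr0.
case: (pickP 'I_d) => [i _|d0]; last first.
  rewrite big_pred0// normr0.
  have e0 x : enorm x = 0 by rewrite /enorm big_pred0// sqrtr0.
  by rewrite !e0 mulr0 mulr0.
have c0 : 0 <= c by exact: le_trans (wc i).
rewrite (le_trans (ler_norm_sum _ _ _))//.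
rewrite (le_trans _ (ler_wpM2l c0 ScS))// /S mulr_sumr ler_sum// => j _.
by rewrite !normrM -mulrA ler_wpM2r// mulr_ge0.
Qed.

Lemma cauchy_schwarz u v : `|\sum_i u i 0 * v i 0| <= enorm u * enorm v.
Proof.
rewrite -[leRHS]mul1r.
have := @weighted_cauchy_schwarz (const_mx 1) u v 1.
under eq_bigr do rewrite mxE mul1r.
by apply => i; rewrite mxE normr1.
Qed.

End euclidean.

(** * Smooth functions *)

Section smooth.
Context {R : realType} {d : nat}.
Variables (V : 'cV[R]_d -> R) (L : R).
Hypothesis V_diff : forall x, differentiable V x.
Hypothesis V_lip : forall x y, enorm (grad V x - grad V y) <= L * enorm (x - y).

Lemma derive_grad x v : 'D_v V x = \sum_i grad V x i 0 * v i 0.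
Proof.
have vE : v = \sum_i v i 0 *: delta_mx i 0.
  by rewrite {1}[v]matrix_sum_delta; apply: eq_bigr => i _; rewrite big_ord1.
rewrite deriveE// {1}vE linear_sum; apply: eq_bigr => i _.
by rewrite linearZ/= -deriveE// mxE mulrC.
Qed.

Lemma is_derive_line x v (t : R) :
  is_derive t 1 (fun s : R => V (x + s *: v))
    (\sum_i grad V (x + t *: v) i 0 * v i 0).
Proof.
(* The difference quotient of the restriction to the line at [t] is that of [V]
   at [x + t v] in the direction [v]. *)
have E : (fun h : R => h^-1 *:
       (((fun s : R => V (x + s *: v)) \o shift t) (h *: 1) - V (x + t *: v)))
   = (fun h : R => h^-1 *: ((V \o shift (x + t *: v)) (h *: v) - V (x + t *: v))).
  apply/funext => h /=; congr (_ *: (V _ - _)).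
  by rewrite scalerDl [h *: 1]mulr1 addrCA.
split; first by rewrite /derivable E; exact: diff_derivable.
by rewrite /derive E -[LHS]/('D_v V (x + t *: v)) derive_grad.
Qed.

(** Along the segment from [x] to [y] the derivative of [V] exceeds its initial
    value by at most [t L |y - x|^2], so that subtracting the parabola leaves a
    function with nonpositive derivative. *)
Lemma descent x y :
  V y <= V x + \sum_i grad V x i 0 * (y - x) i 0 + L / 2 * enorm (y - x) ^+ 2.
Proof.
set v := y - x; set a := \sum_i _.
pose psi (t : R) := V (x + t *: v) - (a * t + L / 2 * enorm v ^+ 2 * t ^+ 2).
pose dpsi (t : R) := \sum_i grad V (x + t *: v) i 0 * v i 0
  - (a + L * enorm v ^+ 2 * t).
have psi_drv (t : R) : is_derive t 1 psi (dpsi t).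
  have := is_derive_line x v t => ?.
  have -> : psi = (fun s => V (x + s *: v)) -
      (a \*: id + (L / 2 * enorm v ^+ 2) \*: (id ^+ 2)) :> (R -> R) by [].
  apply: is_derive_eq; rewrite /dpsi /GRing.scale/= !mulr1 expr1; lra.
have psi_cont : {within `[0, 1]%classic, continuous psi}.
  apply: continuous_subspaceT => t; apply: differentiable_continuous.
  by apply/derivable1_diffP; case: (psi_drv t).
have [c] := @MVT _ psi dpsi 0 1 ltr01 (fun t _ => psi_drv t) psi_cont.
rewrite in_itv/= => /andP[c0 _].
suff : dpsi c <= 0.
  rewrite subr0 mulr1 /psi scale0r scale1r addr0 /v subrKC -/v => dc0 E.
  by move: dc0; rewrite -E expr0n/= expr1n; lra.
rewrite /dpsi opprD addrA subr_le0.
have -> : \sum_i grad V (x + c *: v) i 0 * v i 0 - a =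
    \sum_i (grad V (x + c *: v) - grad V x) i 0 * v i 0.
  rewrite /a -sumrB; apply: eq_bigr => i _; rewrite -mulrBl; congr (_ * _).
  by rewrite [RHS]mxE [X in _ = _ + X]mxE.
rewrite (le_trans (ler_norm _))// (le_trans (cauchy_schwarz _ _))//.
have := V_lip (x + c *: v) x.
rewrite addrAC subrr add0r enormZ (ger0_norm (ltW c0)) => h.
apply: le_trans (ler_wpM2r (enorm_ge0 v) h) _.
by rewrite le_eqVlt; apply/orP; left; apply/eqP; ring.
Qed.

End smooth.

(** * Measurability *)

Section measurability.
Context {R : realType} {dT : measure_display} {T : measurableType dT}.

(** An open set is the union of the countably many balls with rational centre
    and radius that it contains, and membership of [f t] in such a ball is a
    condition on the finitely many coordinates of [f t]. *)
Lemma measurable_continuous_comp {d : nat} (f : T -> 'cV[R]_d)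
    (g : 'cV[R]_d -> R) :
  (forall i, measurable_fun setT (fun t => f t i 0)) -> continuous g ->
  measurable_fun setT (g \o f).
Proof.
move=> mf cg; apply: (measurability _ (RGenOpens.measurableE R)).
move=> _ [_ [a [b ->] <-]]; rewrite setTI comp_preimage.
have : open (g @^-1` `]a, b[%classic).
  by move/continuousP : cg; apply; exact: interval_open.
move: (g @^-1` _) => O oO.
pose center (c : 'cV[rat]_d) : 'cV[R]_d := map_mx ratr c.
pose F (cr : 'cV[rat]_d * rat) : set T :=
  if `[< ball (center cr.1) (ratr cr.2) `<=` O >] then
    f @^-1` (ball (center cr.1) (ratr cr.2)) else set0.
rewrite (_ : f @^-1` O = \bigcup_cr F cr); last first.
  apply/seteqP; split => [t Oft|t [[c r] _]]; last first.
    by rewrite /F; case: ifPn => // /asboolP + ?; apply.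
  have [e e0 eO] : exists2 e, 0 < e & ball (f t) e `<=` O.
    by have /nbhs_ballP[e e0 ?] := open_nbhs_nbhs (conj oO Oft); exists e.
  (* Half of [e] suffices for [f t] to lie in a rational ball inside the ball of
     radius [e] centred at [f t]. *)
  have [r] := rat_in_itvoo (divr_gt0 e0 (ltr0n R 2)).
  rewrite in_itv/= => /andP[r0 re].
  have cE i : exists q : rat, `|f t i 0 - ratr q| < ratr r.
    have fr : f t i 0 - ratr r < f t i 0 + ratr r by lra.
    have [q] := rat_in_itvoo fr.
    by rewrite in_itv/= => q_; exists q; rewrite ltr_norml; lra.
  pose c : 'cV[rat]_d := \col_i projT1 (cid (cE i)).
  have cf : ball (center c) (ratr r) (f t).
    split=> // i j; rewrite !ord1 !mxE /ball/= distrC.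
    exact: (projT2 (cid (cE i))).
  exists (c, r) => //; rewrite /F; case: asboolP => //= -[] y cy; apply: eO.
  apply: (@le_ball _ _ _ (ratr r + ratr r)); first by lra.
  by apply: ball_triangle cy; exact: ball_sym.
apply: countable_bigcupT_measurable => // -[c r]; rewrite /F.
case: ifP => // _.
have [r0|r0] := ltP 0 (ratr r : R); last first.
  rewrite (_ : _ @^-1` _ = set0)//; apply/seteqP; split => // t -[].
  by rewrite ltNge r0.
rewrite (_ : _ @^-1` _ =
    \bigcap_(i in [set: 'I_d])
      [set t | ball (center c i 0) (ratr r) (f t i 0)]).
  apply: fin_bigcap_measurable => // i _.
  rewrite -[X in measurable X]setTI; apply: mf => //; exact: measurable_ball.
apply/seteqP; split => [t [_ h] i _|t h]; first exact: h.
by split => // i j; rewrite !ord1; exact: h.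
Qed.

Lemma measurable_fun_nat_choice {dU : measure_display} {U : measurableType dU}
    (J : T -> nat) (f : nat -> T -> U) :
  measurable_fun setT J -> (forall n, measurable_fun setT (f n)) ->
  measurable_fun setT (fun t => f (J t) t).
Proof.
move=> mJ mf _ B mB; rewrite setTI.
rewrite (_ : _ @^-1` _ = \bigcup_n ((J @^-1` [set n]) `&` (f n @^-1` B))).
  apply: bigcupT_measurable => n; apply: measurableI.
    by rewrite -[X in measurable X]setTI; exact: mJ.
  by rewrite -[X in measurable X]setTI; exact: mf.
by apply/seteqP; split => [t Bt|t [n _ [<-]]]//; exists (J t).
Qed.

Definition bounded_measurable (f : T -> R) : Prop :=
  measurable_fun setT f /\ exists C, forall t, `|f t| <= C.

Lemma bounded_measurable_cst c : bounded_measurable (fun=> c).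
Proof. by split; [exact: measurable_cst|exists `|c|]. Qed.

Lemma bounded_measurableD f g : bounded_measurable f -> bounded_measurable g ->
  bounded_measurable (fun t => f t + g t).
Proof.
move=> [mf [a fa]] [mg [b gb]]; split; first exact: measurable_funD.
by exists (a + b) => t; rewrite (le_trans (ler_normD _ _))// lerD.
Qed.

Lemma bounded_measurableM f g : bounded_measurable f -> bounded_measurable g ->
  bounded_measurable (fun t => f t * g t).
Proof.
move=> [mf [a fa]] [mg [b gb]]; split; first exact: measurable_funM.
by exists (a * b) => t; rewrite normrM ler_pM.
Qed.

Lemma bounded_measurableZ c f : bounded_measurable f ->
  bounded_measurable (fun t => c * f t).
Proof.
by move=> bf; apply: bounded_measurableM => //; exact: bounded_measurable_cst.
Qed.

Lemma bounded_measurableX n f : bounded_measurable f ->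
  bounded_measurable (fun t => f t ^+ n).
Proof.
move=> [mf [a fa]]; split; first exact: measurable_funX.
by exists (a ^+ n) => t; rewrite normrX lerXn2r// nnegrE// (le_trans _ (fa t)).
Qed.

Lemma bounded_measurable_sum I (s : seq I) (f : I -> T -> R) :
  (forall i, bounded_measurable (f i)) ->
  bounded_measurable (fun t => \sum_(i <- s) f i t).
Proof.
move=> bf; elim: s => [|i s ih].
  by under eq_fun do rewrite big_nil; exact: bounded_measurable_cst.
by under eq_fun do rewrite big_cons; exact: bounded_measurableD.
Qed.

Lemma bounded_measurable_enorm {d : nat} (f : T -> 'cV[R]_d) :
  (forall i, bounded_measurable (fun t => f t i 0)) ->
  bounded_measurable (fun t => enorm (f t)).
Proof.
move=> bf.
have [m [C hC]] : bounded_measurable (fun t => \sum_i f t i 0 ^+ 2).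
  by apply: bounded_measurable_sum => i; exact: bounded_measurableX.
split.
  exact: measurableT_comp (continuous_measurable_fun (@sqrt_continuous R)) m.
exists (Num.sqrt C) => t.
by rewrite ger0_norm ?enorm_ge0// ler_wsqrtr// (le_trans (ler_norm _))// hC.
Qed.

End measurability.

(** * Real expectations *)

Section expectations.
Context {R : realType} {dO : measure_display} {Omega : measurableType dO}.
Variable P : probability Omega R.
Local Notation integrable f := (P.-integrable setT (EFin \o f)).
Local Notation "'\E' f" := (Rintegral P setT f) (at level 10, f at level 8).

Lemma bounded_measurable_integrable (f : Omega -> R) :
  bounded_measurable f -> integrable f.
Proof.
move=> [mf [C fC]]; apply: measurable_bounded_integrable => //.
  by rewrite (le_lt_trans (probability_le1 _ _)) ?ltry.
exists C; split; first exact: num_real.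
by move=> x Cx t _ /=; rewrite (le_trans (fC t))// ltW.
Qed.

Lemma integrable_bounded_mul (Y f : Omega -> R) :
  bounded_measurable Y -> integrable f -> integrable (fun w => Y w * f w).
Proof.
move=> [mY [C YC]] intf.
have := @integrableMr _ _ _ P setT measurableT Y (EFin \o f) mY _ intf; apply.
exists C; split; first exact: num_real.
by move=> x Cx t _ /=; rewrite (le_trans (YC t))// ltW.
Qed.

Lemma expectation_Rintegral (f : Omega -> R) : integrable f ->
  ('E_P[f] = (\E f)%:E)%E.
Proof. by move=> intf; rewrite unlock /Rintegral fineK// integrable_fin_num. Qed.

Lemma Rintegral_probability_cst (c : R) : \E (fun=> c) = c.
Proof. by have := expectation_cst P c; rewrite unlock /Rintegral => ->. Qed.

Lemma integrable_real_sum I (s : seq I) (f : I -> Omega -> R) :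
  (forall i, integrable (f i)) -> integrable (fun w => \sum_(i <- s) f i w).
Proof.
move=> intf.
rewrite (_ : EFin \o _ = (fun w => \sum_(i <- s) (EFin \o f i) w)%E).
  exact: integrable_sum.
by apply/funext => w /=; rewrite sumEFin.
Qed.

Lemma Rintegral_sum I (s : seq I) (f : I -> Omega -> R) :
  (forall i, integrable (f i)) ->
  \E (fun w => \sum_(i <- s) f i w) = \sum_(i <- s) \E (f i).
Proof.
move=> intf; elim: s => [|i s ih].
  rewrite big_nil; under eq_Rintegral do rewrite big_nil.
  by rewrite Rintegral_cst// mul0r.
rewrite big_cons -ih -RintegralD//; last exact: integrable_real_sum.
by apply: eq_Rintegral => w _; rewrite big_cons.
Qed.

(** Almost everywhere [g] is the maximum of [f] and [g], which dominates [f]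
    everywhere. *)
Lemma ae_le_Rintegral (f g : Omega -> R) : integrable f -> integrable g ->
  {ae P, forall w, f w <= g w} -> \E f <= \E g.
Proof.
move=> intf intg fg.
have mf : measurable_fun setT f.
  by apply/measurable_EFinP; exact: measurable_int intf.
have mg : measurable_fun setT g.
  by apply/measurable_EFinP; exact: measurable_int intg.
pose h w := Num.max (f w) (g w).
have mh : measurable_fun setT h by exact: measurable_maxr.
have hg : (\int[P]_w (h w)%:E = \int[P]_w (g w)%:E)%E.
  apply: ae_eq_integral => //; try exact/measurable_EFinP.
  by apply: filterS fg => w fgw _; rewrite /h max_r.
have inth : integrable h.
  have intfg :=
    integrableD measurableT (integrable_norm intf) (integrable_norm intg).
  apply: (le_integrable measurableT _ _ intfg); first exact/measurable_EFinP.
  move=> w _; rewrite /= lee_fin /h [leRHS]ger0_norm ?addr_ge0//.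
  by case: (leP (f w) (g w)) => _; rewrite ?lerDl ?lerDr.
have : \E f <= \E h by apply: le_Rintegral => // w _; rewrite /h le_max lexx.
by rewrite /Rintegral hg.
Qed.

End expectations.

(** * Conditional expectations *)

(** Counting the integers up to [y] approximates [y] from its integer part: when
    the range grows to [m + 1], the new level can only be reached by [y > m], and
    then all the previous ones are. *)
Lemma count_le_approx {R : realType} (m : nat) (y : R) : 0 <= y <= m%:R ->
  `|y - \sum_(1 <= j < m.+1) (j%:R <= y)%R%:R| <= 1.
Proof.
elim: m => [|m ih] /andP[y0 ym].
  by rewrite big_geq// subr0 ger0_norm// (le_trans ym).
rewrite big_nat_recr//=; have [ym'|my] := leP y m%:R.
  rewrite (_ : (m.+1%:R <= y) = false) ?addr0; first by rewrite ih// y0.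
  by apply/negbTE; rewrite -ltNge (le_lt_trans ym')// ltr_nat.
have -> : \sum_(1 <= j < m.+1) (j%:R <= y)%R%:R = m%:R :> R.
  rewrite (eq_big_nat _ _ (F2 := fun=> 1)) ?sumr_const_nat ?subn1//.
  move=> j /andP[_ jm]; rewrite (le_trans _ (ltW my))//.
  by rewrite ler_nat -ltnS.
have mE : m.+1%:R = m%:R + 1 :> R by rewrite natr1.
by case: (leP m.+1%:R y) => h; rewrite /= ler_norml; lra.
Qed.

Section pull_out.
Context {R : realType} {dO : measure_display} {Omega : measurableType dO}.
Variable P : probability Omega R.
Local Notation integrable f := (P.-integrable setT (EFin \o f)).
Local Notation "'\E' f" := (Rintegral P setT f) (at level 10, f at level 8).

(** Up to [1 / m], a function with values in [[0, 1]] is the average of the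
    indicators of its superlevel sets at the levels [j / m], against which [h]
    integrates to 0; hence the integral of [Y h] is at most that of [|h|] divided
    by [m], for every [m]. *)
Lemma superlevel_orthogonal01 (Y h : Omega -> R) :
  measurable_fun setT Y -> (forall w, 0 <= Y w <= 1) -> integrable h ->
  (forall a, \int[P]_(w in [set w | a <= Y w]) h w = 0) ->
  \E (fun w => Y w * h w) = 0.
Proof.
move=> mY Y01 inth h0.
have intYh : integrable (fun w => Y w * h w).
  apply: integrable_bounded_mul => //; split=> //; exists 1 => w.
  by have /andP[? ?] := Y01 w; rewrite ger0_norm.
pose A a := [set w | a <= Y w].
have mA a : measurable (A a).
  have := @measurable_fun_ler _ _ _ setT (cst a) Y (measurable_cst _) mY.
  move=> /(_ measurableT [set true] I); rewrite setTI.
  by congr measurable; apply/seteqP; split => w /=; rewrite /A/=.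
have bA a : bounded_measurable (\1_(A a) : Omega -> R).
  split; first exact: measurable_indic.
  by exists 1 => w; rewrite indicE; case: (_ \in _); rewrite ?normr0 ?normr1.
have EA a : \E (fun w => \1_(A a) w * h w) = 0.
  rewrite -(h0 a) [in RHS]Rintegral_mkcond; apply: eq_Rintegral => w _.
  by rewrite patchE indicE -/(A a); case: (w \in A a); rewrite ?mul1r ?mul0r.
have bound m : (0 < m)%N ->
    `|\E (fun w => Y w * h w)| <= m%:R^-1 * \E (fun w => `|h w|).
  move=> m0; have m0' : 0 < m%:R :> R by rewrite ltr0n.
  pose Ym w : R := m%:R^-1 * \sum_(1 <= j < m.+1) \1_(A (j%:R / m%:R)) w.
  have bYm : bounded_measurable Ym.
    by apply: bounded_measurableZ; exact: bounded_measurable_sum.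
  have intYmh : integrable (fun w => Ym w * h w).
    exact: integrable_bounded_mul.
  have intB : integrable (fun w => Y w * h w - Ym w * h w).
    by have := integrableB measurableT intYh intYmh.
  have EYm : \E (fun w => Ym w * h w) = 0.
    transitivity (\E (fun w => \sum_(1 <= j < m.+1)
        m%:R^-1 * (\1_(A (j%:R / m%:R)) w * h w))).
      by apply: eq_Rintegral => w _; rewrite -mulrA mulr_suml mulr_sumr.
    have intA j : integrable (fun w => \1_(A (j%:R / m%:R)) w * h w).
      exact: integrable_bounded_mul.
    rewrite Rintegral_sum; last first.
      move=> j; apply: integrable_bounded_mul => //.
      exact: bounded_measurable_cst.
    by rewrite big1// => j _; rewrite RintegralZl// EA mulr0.
  have -> : \E (fun w => Y w * h w) = \E (fun w => Y w * h w - Ym w * h w).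
    by rewrite RintegralB// EYm subr0.
  rewrite (le_trans (le_normr_Rintegral _ _))//.
  rewrite -RintegralZl//; last exact: integrable_norm.
  apply: le_Rintegral => //.
  - exact: integrable_norm.
  - apply: integrable_bounded_mul; first exact: bounded_measurable_cst.
    exact: integrable_norm.
  move=> w _; rewrite -mulrBl normrM ler_wpM2r//.
  have := @count_le_approx R m (m%:R * Y w); have /andP[Y0 Y1] := Y01 w.
  rewrite mulr_ge0//= ler_piMr// => /(_ isT).
  have -> : Y w - Ym w =
      m%:R^-1 * (m%:R * Y w - \sum_(1 <= j < m.+1) (j%:R <= m%:R * Y w)%R%:R).
    rewrite mulrBr mulKf ?gt_eqF// /Ym; congr (_ - _ * _).
    apply: eq_bigr => j _; rewrite indicE /A; congr (_ *+ nat_of_bool _).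
    apply/idP/idP.
      by rewrite inE/= ler_pdivrMr// mulrC => ->.
    by move=> jY; apply/mem_set => /=; rewrite ler_pdivrMr// mulrC.
  rewrite normrM gtr0_norm ?invr_gt0// => h1.
  by rewrite ler_piMr// invr_ge0 ltW.
apply/eqP; rewrite -normr_le0 leNgt; apply/negP => E0.
set e := `|_| in E0 bound; set S := \E _ in bound.
have [m mS] : exists m, S / e < m%:R.
  exists (Num.bound (S / e)); apply: archi_boundP.
  by rewrite divr_ge0 ?(ltW E0)//; exact: Rintegral_ge0.
have := bound m.+1 isT; apply/negP; rewrite -ltNge mulrC ltr_pdivrMr//.
by rewrite mulrC -ltr_pdivrMr// (lt_trans mS)// ltr_nat.
Qed.

(** The superlevel sets of [Y] are also those of its increasing affine functions,
    one of which has values in [[0, 1]]. *)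
Lemma superlevel_orthogonal (Y h : Omega -> R) :
  bounded_measurable Y -> integrable h ->
  (forall a, \int[P]_(w in [set w | a <= Y w]) h w = 0) ->
  \E (fun w => Y w * h w) = 0.
Proof.
move=> [mY [C YC]] inth h0.
pose D := `|C| + 1; have D0 : 0 < D by rewrite ltr_wpDl.
have YD w : `|Y w| <= D.
  by rewrite (le_trans (YC w))// (le_trans (ler_norm C))// lerDl.
pose Z w := (Y w + D) / (2 * D).
have Z01 w : 0 <= Z w <= 1.
  have := YD w; rewrite ler_norml => /andP[h1 h2].
  rewrite divr_ge0 ?mulr_ge0 ?(ltW D0)//=; last by lra.
  by rewrite ler_pdivrMr ?mulr_gt0//; lra.
have EZ : \E (fun w => Z w * h w) = 0.
  apply: superlevel_orthogonal01 => //.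
    apply: measurable_funM; last exact: measurable_cst.
    by apply: measurable_funD => //; exact: measurable_cst.
  move=> a; rewrite -(h0 (a * (2 * D) - D)); congr (Rintegral _ _ _).
  apply/seteqP; split => w /=; rewrite /Z ler_pdivlMr ?mulr_gt0//; lra.
have Eh : \E h = 0.
  rewrite -(h0 (- D)); congr (Rintegral _ _ _).
  by apply/seteqP; split => w //= _; have := YD w; rewrite ler_norml => /andP[].
have bY : bounded_measurable Y by split=> //; exists C.
have -> : \E (fun w => Y w * h w) =
    \E (fun w => (2 * D) * (Z w * h w) - D * h w).
  apply: eq_Rintegral => w _; rewrite /Z; field; exact: lt0r_neq0.
have intZh : integrable (fun w => Z w * h w).
  apply: integrable_bounded_mul => //; apply: bounded_measurableM.
    by apply: bounded_measurableD => //; exact: bounded_measurable_cst.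
  exact: bounded_measurable_cst.
have intc c (f : Omega -> R) : integrable f -> integrable (fun w => c * f w).
  by apply: integrable_bounded_mul; exact: bounded_measurable_cst.
rewrite RintegralB//; try exact: intc.
by rewrite !RintegralZl// EZ Eh !mulr0 subr0.
Qed.

(** By definition the difference of [f] and its conditional expectation integrates
    to 0 over every event of [F], hence over the superlevel sets of [Y]. *)
Lemma cond_exp_pull_out (F : set (set Omega)) (f g Y : Omega -> R) :
  is_cond_exp P F f g -> F `<=` measurable ->
  bounded_measurable Y -> (forall a, F [set w | a <= Y w]) ->
  \E (fun w => Y w * f w) = \E (fun w => Y w * g w).
Proof.
move=> [intf intg _ fg] Fm bY FY.
apply/eqP; rewrite -subr_eq0 -RintegralB//; try exact: integrable_bounded_mul.
apply/eqP; under eq_Rintegral do rewrite -mulrBr.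
apply: superlevel_orthogonal => //.
  by have := integrableB measurableT intf intg.
move=> a; have mA := Fm _ (FY a).
rewrite RintegralB//; try exact: integrableS intf; try exact: integrableS intg.
by rewrite /Rintegral fg// subrr.
Qed.

End pull_out.

(** * The gradient and the estimator are bounded *)

Section bounds.
Context {R : realType} {d : nat}.

Lemma sup_enorm_le {E : Type} (f : E -> 'cV[R]_d) (G : R) :
  (sup_enorm f <= G%:E)%E -> forall x, enorm (f x) <= G.
Proof.
move=> fG x; rewrite -lee_fin (le_trans _ fG)//.
by apply: ereal_sup_ubound; exists x.
Qed.

(** The squared norm of the mean is the mean of the scalar product with the
    mean, which Cauchy-Schwarz bounds pointwise. *)
Lemma enorm_mean_field_le {dE : measure_display} {E : measurableType dE}
    (H : 'cV[R]_d -> E -> 'cV[R]_d) (pi_ : 'cV[R]_d -> probability E R)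
    (theta : 'cV[R]_d) (G : R) :
  (forall i, measurable_fun setT (fun x => H theta x i 0)) ->
  (forall x, enorm (H theta x) <= G) ->
  enorm (mean_field H pi_ theta) <= G.
Proof.
move=> mH HG; set h := mean_field H pi_ theta.
have bH i : bounded_measurable (fun x => H theta x i 0).
  by split=> //; exists G => x; rewrite (le_trans (coord_le_enorm _ _)).
have bhH i : bounded_measurable (fun x => h i 0 * H theta x i 0).
  exact: bounded_measurableZ.
have G0 : 0 <= G by exact: le_trans (enorm_ge0 _) (HG point).
have : enorm h ^+ 2 <= enorm h * G.
  rewrite enorm_sqr.
  have -> : \sum_i h i 0 ^+ 2 =
      \int[pi_ theta]_x (\sum_i h i 0 * H theta x i 0).
    rewrite Rintegral_sum => [|i]; last exact: bounded_measurable_integrable.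
    apply: eq_bigr => i _; rewrite RintegralZl//.
      by rewrite expr2; congr (_ * _); rewrite mxE.
    exact: bounded_measurable_integrable.
  rewrite (le_trans (y := \int[pi_ theta]_x (enorm h * G)))//; last first.
    by rewrite Rintegral_probability_cst.
  apply: le_Rintegral => //.
  - exact/bounded_measurable_integrable/bounded_measurable_sum.
  - exact/bounded_measurable_integrable/bounded_measurable_cst.
  move=> x _; rewrite (le_trans (ler_norm _))//.
  rewrite (le_trans (cauchy_schwarz _ _))//.
  by rewrite ler_wpM2l// enorm_ge0.
have := enorm_ge0 h; rewrite le_eqVlt => /predU1P[<-//|h0].
by rewrite expr2 ler_pM2l.
Qed.

Variables (E : Type) (H : 'cV[R]_d -> E -> 'cV[R]_d) (G : R).
Hypothesis H_le : forall theta x, enorm (H theta x) <= G.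

Lemma coord_empirical_mean_le theta p (x : nat -> E) i :
  `|empirical_mean H theta p x i 0| <= G.
Proof.
have HG y : `|H theta y i 0| <= G by rewrite (le_trans (coord_le_enorm _ _)).
rewrite mxE summxE; case: p => [|p].
  by rewrite invr0 mul0r normr0 (le_trans _ (HG (x 0%N))).
rewrite normrM normfV normr_nat ler_pdivrMl ?ltr0n//.
rewrite (le_trans (ler_norm_sum _ _ _))//.
rewrite (le_trans (ler_sum _ (fun j _ => HG (x j))))//.
by rewrite sumr_const_nat subn1 mulr_natl.
Qed.

(** Truncating at level [tau] caps the factor [t] of the correction term. *)
Lemma coord_mlmc_le tau theta k (x : nat -> E) i : 0 <= tau ->
  `|mlmc H tau theta k x i 0| <= G + tau * (G + G).
Proof.
move=> tau0; have G0 : 0 <= G by exact: le_trans (enorm_ge0 _) (H_le 0 (x 0%N)).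
rewrite mxE (le_trans (ler_normD _ _))// lerD//.
  by rewrite (le_trans (coord_le_enorm _ _)).
case: ifPn => [ttau|_]; last by rewrite mxE normr0 mulr_ge0// addr_ge0.
rewrite mxE normrM normr_nat ler_pM//.
rewrite mxE [X in _ + X]mxE (le_trans (ler_normB _ _))//.
by rewrite lerD// coord_empirical_mean_le.
Qed.

End bounds.

(** * The adaptive step sizes *)

Section step_sizes.
Context {R : realType} {d : nat}.
Variables (eps M : nat -> R).
Hypothesis eps_gt0 : forall n, (1 <= n)%N -> 0 < eps n.
Implicit Types (n m : nat) (i : 'I_d).

(** The [i]-th diagonal entry of [A_n], except that only the first [m] squared
    gradients are accumulated: [m = n + 1] gives [A_n] itself, and [m = n] its
    predictable part, which does not see the estimator it multiplies. *)
Definition step_size {Omega : Type} (Hh : nat -> Omega -> 'cV[R]_d) n m i w :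
  R :=
  (eps n.+1 ^- 2
   + n.+1%:R^-1 * \sum_(0 <= k < m) Num.min (Hh k w i 0 ^+ 2) (M k ^+ 2))
  `^ (- 2^-1).

Lemma adagrad_matrix_coord {Omega : Type} (Hh : nat -> Omega -> 'cV[R]_d) n w
    (u : 'cV[R]_d) i :
  (adagrad_matrix eps M Hh n w *m u) i 0 = step_size Hh n n.+1 i w * u i 0.
Proof.
rewrite /adagrad_matrix /diag_invsqrt mul_diag_mx mxE; congr (_ * _).
rewrite !mxE eqxx mulr1n summxE /step_size; congr ((_ + _ * _) `^ _).
by apply: eq_bigr => k _; rewrite !mxE eqxx mulr1n.
Qed.

Lemma powRN2_sqr (a : R) : 0 < a -> (a `^ (- 2^-1)) ^- 2 = a.
Proof.
move=> a0; rewrite powRN powR12_sqrt ?ltW// exprVn invrK sqr_sqrtr//.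
exact: ltW.
Qed.

Lemma powRN2_anti (a b : R) : 0 < a -> a <= b ->
  b `^ (- 2^-1) <= a `^ (- 2^-1).
Proof.
move=> a0 ab; have b0 := lt_le_trans a0 ab.
rewrite !powRN lef_pV2 ?posrE ?powR_gt0//.
by rewrite ge0_ler_powR// nnegrE ltW// (lt_le_trans a0).
Qed.

Lemma powRN2_exprN2 (e : R) : 0 < e -> (e ^- 2) `^ (- 2^-1) = e.
Proof.
move=> e0; rewrite powRN powR12_sqrt ?invr_ge0 ?sqr_ge0//.
by rewrite sqrtrV ?sqr_ge0// sqrtr_sqr invrK gtr0_norm.
Qed.

(** For [p = a^(-1/2)] and [r = (a + delta)^(-1/2)], the increment [delta] is
    [(p - r) (p + r) / (p r)^2], and [r <= p]. *)
Lemma powRN2_sub (a delta : R) : 0 < a -> 0 <= delta ->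
  a `^ (- 2^-1) - (a + delta) `^ (- 2^-1) <= delta * (a `^ (- 2^-1)) ^+ 3.
Proof.
move=> a0 delta0.
have ad0 : 0 < a + delta by rewrite ltr_wpDr.
have aad : a <= a + delta by rewrite lerDl.
have rp := powRN2_anti a0 aad.
have := powR_gt0 (- 2^-1) ad0; have := powR_gt0 (- 2^-1) a0.
have aE := powRN2_sqr a0; have adE := powRN2_sqr ad0.
move: rp aE adE; set p := a `^ _; set r := (a + delta) `^ _ => rp aE adE p0 r0.
have -> : delta * p ^+ 3 = (p - r) * ((p + r) * p / r ^+ 2).
  have -> : delta = r ^- 2 - p ^- 2 by rewrite aE adE; ring.
  by field; rewrite !gt_eqF.
rewrite ler_peMr ?subr_ge0// ler_pdivlMr ?exprn_gt0// mul1r.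
by rewrite expr2 ler_pM// ?(ltW r0)// lerDr ltW.
Qed.

Section bounds.
Context {Omega : Type}.
Variables (Hh : nat -> Omega -> 'cV[R]_d).

Let clip_ge0 k w i : 0 <= Num.min (Hh k w i 0 ^+ 2) (M k ^+ 2).
Proof. by rewrite le_min !sqr_ge0. Qed.

Let sum_ge0 n m i w : 0 <= n.+1%:R^-1 *
  \sum_(0 <= k < m) Num.min (Hh k w i 0 ^+ 2) (M k ^+ 2).
Proof. by rewrite mulr_ge0// sumr_ge0. Qed.

Let epsN2_gt0 n : 0 < eps n.+1 ^- 2.
Proof. by rewrite invr_gt0 exprn_gt0// eps_gt0. Qed.

Lemma step_size_ge0 n m i w : 0 <= step_size Hh n m i w.
Proof. exact: powR_ge0. Qed.

Lemma step_size_le n m i w : step_size Hh n m i w <= eps n.+1.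
Proof.
rewrite -[leRHS]powRN2_exprN2 ?eps_gt0//.
by apply: powRN2_anti => //; rewrite lerDl.
Qed.

Lemma step_size_anti n i w : step_size Hh n n.+1 i w <= step_size Hh n n i w.
Proof.
apply: powRN2_anti; first by rewrite ltr_wpDr.
by rewrite lerD2l ler_wpM2l// big_nat_recr//= lerDl.
Qed.

(** Replacing the step size by its predictable part costs a third power of the
    estimator once it is multiplied by it: this is where the third moment
    enters. *)
Lemma step_size_predictable n i w :
  `|step_size Hh n n i w - step_size Hh n n.+1 i w| <=
  eps n.+1 ^+ 3 / n.+1%:R * enorm (Hh n w) ^+ 2.
Proof.
rewrite ger0_norm ?subr_ge0 ?step_size_anti//.
set delta := n.+1%:R^-1 * Num.min (Hh n w i 0 ^+ 2) (M n ^+ 2).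
have delta0 : 0 <= delta by rewrite mulr_ge0.
have -> : step_size Hh n n.+1 i w = (eps n.+1 ^- 2 + n.+1%:R^-1 *
    (\sum_(0 <= k < n) Num.min (Hh k w i 0 ^+ 2) (M k ^+ 2)) + delta)
    `^ (- 2^-1).
  by rewrite /step_size big_nat_recr//= mulrDr addrA.
apply: le_trans (powRN2_sub _ delta0) _; first by rewrite ltr_wpDr.
rewrite -[_ `^ _]/(step_size Hh n n i w).
rewrite (_ : eps n.+1 ^+ 3 / n.+1%:R * enorm (Hh n w) ^+ 2 =
    n.+1%:R^-1 * enorm (Hh n w) ^+ 2 * eps n.+1 ^+ 3); last first.
  by rewrite [RHS]mulrC [RHS]mulrA.
apply: ler_pM => //; first by rewrite exprn_ge0// step_size_ge0.
  rewrite ler_wpM2l// ge_min enorm_sqr (bigD1 i)//= lerDl.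
  by rewrite sumr_ge0// => j _; rewrite sqr_ge0.
by rewrite lerXn2r ?nnegrE ?step_size_ge0 ?step_size_le// ltW// eps_gt0.
Qed.

(** Only [n] clipped squares are accumulated but they are divided by [n + 1], so
    their average is at most the largest clipping threshold. *)
Lemma eps_low_le n i w : eps_low eps M n <= step_size Hh n n i w.
Proof.
case: n => [|n].
  by rewrite /step_size big_geq// mulr0 addr0 powRN2_exprN2// eps_gt0.
apply: powRN2_anti; first by rewrite ltr_wpDr.
rewrite lerD2l; set mx := \big[Num.max/0]_(_ <= _ < _) _.
have Mmx k : (k < n.+1)%N -> M k ^+ 2 <= mx.
  move=> kn.
  apply: (@le_bigmax_seq _ _ _ _ 0 k xpredT (fun j => M j ^+ 2)) => //.
  by rewrite mem_index_iota.
have mx0 : 0 <= mx by rewrite (le_trans _ (Mmx 0%N _))// sqr_ge0.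
rewrite ler_pdivrMl ?ltr0n//.
have : \sum_(0 <= k < n.+1) Num.min (Hh k w i 0 ^+ 2) (M k ^+ 2) <=
    \sum_(0 <= k < n.+1) mx.
  rewrite !big_nat; apply: ler_sum => k /andP[_ kn].
  by rewrite ge_min Mmx ?orbT.
move/le_trans; apply.
by rewrite sumr_const_nat subn0 -[leLHS]mulr_natl ler_wpM2r// ler_nat.
Qed.

End bounds.

Lemma eps_low_gt0 n : 0 < eps_low eps M n.
Proof.
case: n => [|n]; first exact: eps_gt0.
rewrite powR_gt0// ltr_pwDl ?invr_gt0 ?exprn_gt0 ?eps_gt0//.
by elim/big_ind: _ => // [x y x0 y0|k _]; rewrite ?le_max ?x0 ?sqr_ge0.
Qed.

End step_sizes.

(** * One step of the algorithm *)

(** For [m = g] the weighted scalar product is at least [l |g|^2]; the rest is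
    linear in the bias [m - g]. *)
Lemma weighted_sum_perturbation {R : realType} {d : nat}
    (p g m : 'cV[R]_d) (l e b c : R) :
  0 <= e -> (forall i, l <= p i 0) -> (forall i, `|p i 0| <= e) ->
  enorm g <= b -> enorm (m - g) <= c ->
  l * enorm g ^+ 2 - e * (b * c) <= \sum_i p i 0 * g i 0 * m i 0.
Proof.
move=> e0 lp pe gb mgc.
have -> : \sum_i p i 0 * g i 0 * m i 0 =
    \sum_i p i 0 * g i 0 ^+ 2 + \sum_i p i 0 * g i 0 * (m - g) i 0.
  rewrite -big_split/=; apply: eq_bigr => i _.
  by rewrite [(m - g) i 0]mxE [(- g) i 0]mxE; ring.
apply: lerD.
  by rewrite enorm_sqr mulr_sumr ler_sum// => i _; rewrite ler_wpM2r// sqr_ge0.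
rewrite lerNl (le_trans (ler_norm _))// normrN.
rewrite (le_trans (weighted_cauchy_schwarz _ _ pe))//.
by rewrite ler_wpM2l// ler_pM// enorm_ge0.
Qed.

Section one_step.
Context {R : realType} {d : nat}.
Variables (V : 'cV[R]_d -> R) (L : R).
Hypothesis L_ge0 : 0 <= L.
Hypothesis V_diff : forall x, differentiable V x.
Hypothesis V_lip : forall x y, enorm (grad V x - grad V y) <= L * enorm (x - y).
Variables (x y u a p : 'cV[R]_d) (gamma b c e : R).
Hypothesis gamma_ge0 : 0 <= gamma.
Hypothesis gradV_le : enorm (grad V x) <= b.
Hypothesis y_step : forall i, y i 0 = x i 0 - gamma * (a i 0 * u i 0).
Hypothesis a_le : forall i, 0 <= a i 0 <= e.
Hypothesis ap_le : forall i, `|p i 0 - a i 0| <= c * enorm u ^+ 2.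

(** In the descent inequality the step sizes [a] may be exchanged for [p] at the
    cost of a cubic term. *)
Lemma descent_step : (0 < d)%N ->
  V y <= V x - gamma * \sum_i p i 0 * grad V x i 0 * u i 0
    + gamma * (c * b * enorm u ^+ 3)
    + L / 2 * gamma ^+ 2 * e ^+ 2 * enorm u ^+ 2.
Proof.
move=> d0.
have i0 : 'I_d := Ordinal d0.
have c0 : 0 <= c * enorm u ^+ 2 by exact: le_trans (ap_le i0).
have e0 : 0 <= e by have /andP[h1 h2] := a_le i0; exact: le_trans h2.
have yx i : (y - x) i 0 = - (gamma * (a i 0 * u i 0)).
  by rewrite mxE [X in _ + X]mxE y_step addrAC subrr add0r.
apply: (le_trans (descent V_diff V_lip x y)).
have quad : enorm (y - x) ^+ 2 <= gamma ^+ 2 * e ^+ 2 * enorm u ^+ 2.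
  rewrite -!exprMn lerXn2r ?nnegrE ?mulr_ge0 ?enorm_ge0//.
  have := @ler_enorm R d (y - x) ((gamma * e) *: u).
  rewrite enormZ ger0_norm ?mulr_ge0//; apply => i.
  rewrite yx mxE normrN !normrM -mulrA ler_wpM2l// ler_wpM2r//.
  by have /andP[a0 ae] := a_le i; rewrite !ger0_norm.
have cubic :
    `|\sum_i (p - a) i 0 * grad V x i 0 * u i 0| <= c * b * enorm u ^+ 3.
  apply: le_trans (weighted_cauchy_schwarz (c := c * enorm u ^+ 2) _ _ _) _.
    by move=> i; rewrite mxE [X in _ + X]mxE.
  have -> : c * b * enorm u ^+ 3 = c * enorm u ^+ 2 * (b * enorm u) by ring.
  by rewrite ler_wpM2l// ler_wpM2r// enorm_ge0.
have lin : \sum_i grad V x i 0 * (y - x) i 0 =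
    - (gamma * \sum_i p i 0 * grad V x i 0 * u i 0)
    + gamma * \sum_i (p - a) i 0 * grad V x i 0 * u i 0.
  rewrite !mulr_sumr -sumrN -big_split/=; apply: eq_bigr => i _.
  by rewrite yx [(p - a) i 0]mxE [(- a) i 0]mxE; ring.
rewrite lin; have := ler_wpM2l gamma_ge0 (ler_normlW cubic).
have := ler_wpM2l (divr_ge0 L_ge0 (ler0n R 2)) quad.
by lra.
Qed.

End one_step.

(** * Sub-sigma-algebras *)

Section sub_sigma_algebra.
Context {R : realType} {dO : measure_display} {Omega : measurableType dO}.
Implicit Types (G : set (set Omega)) (f : Omega -> R).

(** Measurability with respect to a sub-sigma-algebra is measurability on the
    same space equipped with the generated structure. *)
Definition bounded_adapted G f : Prop :=
  @bounded_measurable R _ (g_sigma_algebraType G) f.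

Lemma bounded_adapted_le G1 G2 f : <<s G1 >> `<=` <<s G2 >> ->
  bounded_adapted G1 f -> bounded_adapted G2 f.
Proof. by move=> G12 [mf bf]; split=> // mD B mB; apply: G12; exact: mf. Qed.

Lemma bounded_adapted_measurable G f : <<s G >> `<=` measurable ->
  bounded_adapted G f -> bounded_measurable f.
Proof. by move=> GT [mf bf]; split=> // mD B mB; apply: GT; exact: mf. Qed.

Lemma superlevel_adapted G f a : bounded_adapted G f ->
  <<s G >> [set w | a <= f w].
Proof.
move=> [mf _].
have := mf measurableT `[a, +oo[%classic (measurable_itv _).
by rewrite setTI; congr (<<s G >> _); apply/seteqP; split => w /=;
  rewrite in_itv/= andbT.
Qed.

End sub_sigma_algebra.

(** * A random index independent of the algorithm *)

Section random_index.
Context {R : realType} {dO : measure_display} {Omega : measurableType dO}.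
Variable P : probability Omega R.
Variables (N : nat) (J : Omega -> nat) (p : nat -> R).
Variables (G : set (set Omega)) (f : nat -> Omega -> R) (C : R).
Hypothesis J_meas : measurable_fun setT J.
Hypothesis J_law : forall n, (n <= N)%N -> P [set w | J w = n] = (p n)%:E.
Hypothesis p_sum : \sum_(0 <= n < N.+1) p n = 1.
Hypothesis J_indep :
  independent P (preimage_set_system setT J measurable) <<s G >>.
Hypothesis G_meas : <<s G >> `<=` measurable.
Hypothesis f_adapted : forall n, bounded_adapted G (f n).
Hypothesis f_le : forall n w, `|f n w| <= C.
Local Notation "'\E' f" := (Rintegral P setT f) (at level 10, f at level 8).

Let one n : Omega -> R := \1_[set w | J w = n].

Let meas_one n : measurable [set w | J w = n].
Proof.
have : measurable (setT `&` J @^-1` [set n]) by exact: J_meas.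
by rewrite setTI.
Qed.

Let bounded_one n : bounded_measurable (one n).
Proof.
split; first exact: measurable_indic.
by exists 1 => w; rewrite /one indicE; case: (_ \in _); rewrite ?normr0 ?normr1.
Qed.

Let bounded_f n : bounded_measurable (f n).
Proof. exact: bounded_adapted_measurable (f_adapted n). Qed.

Let expectation_one n : (n <= N)%N -> \E (one n) = p n.
Proof.
by move=> nN; rewrite /Rintegral integral_indic// setIT [X in fine X]J_law.
Qed.

(** By independence the probability of [J = n] is the conditional expectation of
    its indicator, which can therefore be replaced by it. *)
Lemma expectation_one_mul n : (n <= N)%N ->
  \E (fun w => one n w * f n w) = p n * \E (f n).
Proof.
move=> nN.
have ce : is_cond_exp P <<s G >> (one n) (fun=> p n).
  split.
  - exact: bounded_measurable_integrable.
  - exact/bounded_measurable_integrable/bounded_measurable_cst.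
  - move=> B mB.
    have : @measurable_fun _ _ (g_sigma_algebraType G) R setT (cst (p n)).
      exact: measurable_cst.
    by move=> /(_ measurableT B mB); rewrite setTI.
  move=> A GA; have mA := G_meas GA.
  rewrite integral_cst// integral_indic//.
  have JnA : preimage_set_system setT J measurable [set w | J w = n].
    by exists [set n] => //; rewrite setTI.
  by apply/esym; have := J_indep JnA GA; rewrite J_law.
have := cond_exp_pull_out ce G_meas (bounded_f n)
  (fun a => superlevel_adapted a (f_adapted n)).
rewrite RintegralZr//; last exact: bounded_measurable_integrable.
rewrite [RHS]mulrC => <-.
by apply: eq_Rintegral => w _; rewrite mulrC.
Qed.

Lemma bounded_random_index : bounded_measurable (fun w => f (J w) w).
Proof.
split; last by exists C => w.
by apply: measurable_fun_nat_choice => // n; have [] := bounded_f n.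
Qed.

(** The event [N < J] is null, as [p] sums to 1, and [f] is bounded on it by
    [C]. *)
Lemma expectation_random_index :
  \E (fun w => f (J w) w) <= \sum_(0 <= n < N.+1) p n * \E (f n).
Proof.
pose S w := \sum_(0 <= n < N.+1) one n w.
have bS : bounded_measurable S by exact: bounded_measurable_sum.
have b1f n : bounded_measurable (fun w => one n w * f n w).
  exact: bounded_measurableM.
pose g w := \sum_(0 <= n < N.+1) one n w * f n w.
have bg : bounded_measurable g by exact: bounded_measurable_sum.
have fJ w : f (J w) w <= g w + C * (1 - S w).
  have oneE n : one n w = (J w == n)%:R.
    by rewrite /one indicE; congr (_ *+ nat_of_bool _);
      apply/idP/eqP => [/set_mem|/mem_set].
  have [JN|NJ] := leqP (J w) N.
    rewrite /S /g (bigD1_seq (J w)) ?mem_index_iota ?iota_uniq//=.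
    rewrite (bigD1_seq (J w) (r := index_iota 0 N.+1) (F := one^~ w))
      ?mem_index_iota ?iota_uniq//=.
    rewrite !big1 ?oneE ?eqxx ?addr0 ?mul1r ?subrr ?mulr0 ?addr0// => n;
      by rewrite oneE eq_sym => /negbTE ->; rewrite ?mul0r.
  have z n : (0 <= n < N.+1)%N -> one n w = 0.
    move=> /andP[_ nN]; rewrite oneE gtn_eqF//; exact: leq_ltn_trans NJ.
  rewrite /S /g !big_nat [X in X + _]big1 ?[X in _ - X]big1.
  - by rewrite add0r subr0 mulr1 (le_trans (ler_norm _)).
  - by move=> n /z.
  - by move=> n /z ->; rewrite mul0r.
have bC1S : bounded_measurable (fun w => C * (1 - S w)).
  apply: bounded_measurableZ; apply: bounded_measurableD.
    exact: bounded_measurable_cst.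
  by under eq_fun do rewrite -mulN1r; exact: bounded_measurableZ.
have bint := @bounded_measurable_integrable _ _ _ P.
have ES : \E S = 1.
  rewrite Rintegral_sum => [|n]; last exact: bint.
  rewrite -p_sum !big_nat; apply: eq_bigr => n /andP[_ nN].
  exact: expectation_one.
apply: (@le_trans _ _ (\E (fun w => g w + C * (1 - S w)))).
  apply: le_Rintegral => //; first exact/bint/bounded_random_index.
  exact/bint/bounded_measurableD.
rewrite RintegralD//; try exact: bint.
rewrite RintegralZl//; last first.
  have b1 : @bounded_measurable R _ Omega (fun=> 1).
    exact: bounded_measurable_cst.
  by have := integrableB measurableT (bint _ b1) (bint _ bS).
rewrite RintegralB//; [|exact/bint/bounded_measurable_cst|exact: bint].
rewrite ES Rintegral_probability_cst subrr mulr0 addr0.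
rewrite Rintegral_sum => [|n]; last exact: bint.
rewrite !big_nat; apply: ler_sum => n /andP[_ nN].
by rewrite expectation_one_mul.
Qed.

End random_index.

(** * The algorithm is adapted and bounded *)

Section adaptedness.
Context {R : realType} {d : nat} {dE dO : measure_display}.
Context {E : measurableType dE} {Omega : measurableType dO}.
Variables (K : nat -> Omega -> nat) (X : nat -> nat -> Omega -> E).
Hypothesis K_meas : forall n, (1 <= n)%N -> measurable_fun setT (K n).
Hypothesis X_meas : forall n i, (1 <= n)%N -> (1 <= i)%N ->
  measurable_fun setT (X n i).

(** This generates [history K X n]; naming the generator gives access to the
    measurable structure that it induces on the sample space. *)
Definition rounds (n : nat) : set (set Omega) :=
  \bigcup_(j in [set j | (1 <= j <= n)%N]) round K X j.

Lemma round_measurable n : (1 <= n)%N -> round K X n `<=` measurable.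
Proof.
move=> n1 A [[B mB <-]|[i i1 [B mB <-]]]; first exact: K_meas.
exact: X_meas.
Qed.

Lemma history_measurable n : <<s rounds n >> `<=` measurable.
Proof.
apply: smallest_sub; first exact: sigma_algebra_measurable.
by move=> A [j /andP[j1 _]]; exact: round_measurable.
Qed.

Lemma full_history_measurable : full_history K X `<=` measurable.
Proof.
apply: smallest_sub; first exact: sigma_algebra_measurable.
by move=> A [j j1]; exact: round_measurable.
Qed.

Lemma history_le n m : (n <= m)%N -> <<s rounds n >> `<=` <<s rounds m >>.
Proof.
move=> nm; apply: sub_sigma_algebra2 => A [j /andP[j1 jn] rA].
by exists j => //=; rewrite j1 (leq_trans jn).
Qed.

Lemma history_full n : <<s rounds n >> `<=` full_history K X.
Proof.
by apply: sub_sigma_algebra2 => A [j /andP[j1 _] rA]; exists j.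
Qed.

Variables (H : 'cV[R]_d -> E -> 'cV[R]_d) (G : R).
Hypothesis H_le : forall theta x, enorm (H theta x) <= G.
Variables (gamma T eps M : nat -> R).
Hypothesis T_gt0 : forall n, (1 <= n)%N -> 0 < T n.
Hypothesis eps_gt0 : forall n, (1 <= n)%N -> 0 < eps n.
Variables (theta0 : 'cV[R]_d) (theta : nat -> Omega -> 'cV[R]_d).
Hypothesis HX_meas : forall n i j (B : set R), (1 <= i)%N -> measurable B ->
  history K X n.+1 [set w | B (H (theta n w) (X n.+1 i w) j 0)].
Hypothesis theta_rec : mlmc_adagrad H eps M gamma T K X theta0 theta.
Local Notation Hh := (Hhat H T K X theta).
Local Notation adapted n f := (bounded_adapted (rounds n) f).

(** For each value [k] of the level, the estimator is a finite combination of the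
    vectors [H_theta(X_i)], whose measurability is given. *)
Lemma Hhat_adapted n i : adapted n.+1 (fun w => Hh n w i 0).
Proof.
split; last first.
  exists (G + T n.+1 * (G + G)) => w.
  by apply: coord_mlmc_le => //; exact/ltW/T_gt0.
pose F := g_sigma_algebraType (rounds n.+1).
have mK : @measurable_fun _ _ F nat setT (K n.+1).
  move=> _ B mB; apply: sub_sigma_algebra; exists n.+1.
    by rewrite /= leqnn.
  by left; exists B.
apply: (@measurable_fun_nat_choice _ F _ _ (K n.+1)
  (fun k w => mlmc H (T n.+1) (theta n w) k (fun l => X n.+1 l w) i 0) mK) => k.
have mHX l : @measurable_fun _ _ F R setT
    (fun w => H (theta n w) (X n.+1 l.+1 w) i 0).
  by move=> _ B mB; rewrite setTI; exact: HX_meas.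
have mmean p : @measurable_fun _ _ F R setT
    (fun w => empirical_mean H (theta n w) p (fun l => X n.+1 l w) i 0).
  under eq_fun do rewrite mxE summxE big_add1/=.
  apply: measurable_funM; first exact: measurable_cst.
  exact: measurable_sum.
rewrite /mlmc; under eq_fun do rewrite mxE.
apply: measurable_funD; first exact: mHX.
case: ((2 ^ k)%:R <= T n.+1); last exact: measurable_cst.
under eq_fun do rewrite mxE.
apply: measurable_funM; first exact: measurable_cst.
under eq_fun do rewrite mxE [X in _ + X]mxE.
exact: measurable_funB.
Qed.

Lemma step_size_adapted q n m i : (m <= q)%N ->
  adapted q (step_size eps M Hh n m i).
Proof.
move=> mq; split; last first.
  by exists (eps n.+1) => w; rewrite ger0_norm ?step_size_ge0 ?step_size_le.
pose F := g_sigma_algebraType (rounds q).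
have mpow : measurable_fun setT (fun x : R => x `^ (- 2^-1)).
  exact: measurable_powR.
apply: (measurableT_comp (T1 := F) mpow).
apply: measurable_funD; first exact: measurable_cst.
apply: measurable_funM; first exact: measurable_cst.
rewrite (_ : (fun w => _) = (fun w => \sum_(k <- index_iota 0 m)
    if (k < m)%N then Num.min (Hh k w i 0 ^+ 2) (M k ^+ 2) else 0)).
  apply: measurable_sum => k; case km : (k < m)%N; last exact: measurable_cst.
  apply: measurable_minr; last exact: measurable_cst.
  apply: measurable_funX.
  have : adapted q (fun w => Hh k w i 0).
    exact: bounded_adapted_le (history_le (leq_trans km mq)) (Hhat_adapted k i).
  by case.
by apply/funext => w; rewrite !big_nat; apply: eq_bigr => k /andP[_ ->].
Qed.

Lemma theta_step n w i : theta n.+1 w i 0 =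
  theta n w i 0 - gamma n.+1 * (step_size eps M Hh n n.+1 i w * Hh n w i 0).
Proof.
have [_ ->] := theta_rec.
by rewrite mxE [X in _ + X]mxE [X in - X]mxE adagrad_matrix_coord.
Qed.

Lemma theta_adapted n i : adapted n (fun w => theta n w i 0).
Proof.
elim: n => [|n ih].
  have [t0 _] := theta_rec; under eq_fun do rewrite t0.
  exact: (@bounded_measurable_cst _ _ (g_sigma_algebraType (rounds 0))).
under eq_fun do rewrite theta_step.
pose F := g_sigma_algebraType (rounds n.+1).
apply: (@bounded_measurableD _ _ F (fun w => theta n w i 0)).
  exact: bounded_adapted_le (history_le (leqnSn n)) ih.
under eq_fun do rewrite -mulNr.
apply: (@bounded_measurableZ _ _ F).
apply: (@bounded_measurableM _ _ F); first exact: step_size_adapted.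
exact: Hhat_adapted.
Qed.

End adaptedness.

(** * One step in expectation *)

Section expected_step.
Context {R : realType} {d : nat}.
Variables (V : 'cV[R]_d -> R) (L : R).
Hypothesis d_gt0 : (0 < d)%N.
Hypothesis V_diff : forall x, differentiable V x.
Hypothesis V_lip : forall x y, enorm (grad V x - grad V y) <= L * enorm (x - y).

Lemma lipschitz_constant_ge0 : 0 <= L.
Proof.
pose x : 'cV[R]_d := const_mx 1.
have x_gt0 : 0 < enorm x.
  have := coord_le_enorm x (Ordinal d_gt0); rewrite mxE normr1.
  exact: lt_le_trans.
have := le_trans (enorm_ge0 _) (V_lip x 0).
by rewrite subr0 pmulr_lge0.
Qed.

Lemma continuous_grad_coord i : continuous (fun x => grad V x i 0).
Proof.
move=> x; apply/(@cvgrPdist_lt _ _ _ (nbhs x)) => e e0.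
have D0 : 0 < L * d%:R + 1.
  by rewrite ltr_wpDl// mulr_ge0 ?lipschitz_constant_ge0.
apply/nbhs_ballP; exists (e / (L * d%:R + 1)); first exact: divr_gt0.
move=> y; rewrite -ball_normE/= ltr_pdivlMr// => xy.
apply: le_lt_trans xy.
have -> : grad V x i 0 - grad V y i 0 = (grad V x - grad V y) i 0.
  by rewrite [RHS]mxE [X in _ = _ + X]mxE.
rewrite (le_trans (coord_le_enorm _ _))// (le_trans (V_lip _ _))//.
rewrite mulrDr mulr1 ler_wpDr// mulrCA.
by rewrite ler_wpM2l ?lipschitz_constant_ge0// mulrC enorm_le_mx_norm.
Qed.

Context {dO : measure_display} {Omega : measurableType dO}.
Variable P : probability Omega R.
Local Notation "'\E' f" := (Rintegral P setT f) (at level 10, f at level 8).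

Variables (Vmin b : R).
Hypothesis V_ge : forall x, Vmin <= V x.
Hypothesis grad_le : forall x, enorm (grad V x) <= b.

(** [V] is bounded below by its minimum, and above by the quadratic function of
    the descent inequality at the origin. *)
Lemma bounded_measurable_objective (x : Omega -> 'cV[R]_d) :
  (forall i, bounded_measurable (fun w => x w i 0)) ->
  bounded_measurable (fun w => V (x w)).
Proof.
move=> bx; split.
  apply: (measurable_continuous_comp (g := V)) => [i|y].
    by have [] := bx i.
  exact: differentiable_continuous.
have [_ [C UC]] : bounded_measurable (fun w =>
    \sum_i grad V 0 i 0 * x w i 0 + L / 2 * enorm (x w) ^+ 2).
  apply: bounded_measurableD.
    by apply: bounded_measurable_sum => i; exact: bounded_measurableZ.
  apply: bounded_measurableZ; apply: bounded_measurableX.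
  exact: bounded_measurable_enorm.
exists (`|Vmin| + (`|V 0| + C)) => w.
have := descent V_diff V_lip 0 (x w); rewrite subr0 => Vx.
have := UC w; have := V_ge (x w).
have := ler_norm (V 0); have := ler_norm (- Vmin); rewrite normrN.
have := normr_ge0 Vmin; have := normr_ge0 (V 0).
rewrite ler_norml => ? ? ? ? ?; rewrite ler_norml => /andP[? ?].
by apply/andP; split; lra.
Qed.

Lemma bounded_adapted_grad_coord (G : set (set Omega))
    (x : Omega -> 'cV[R]_d) i :
  (forall j, bounded_adapted G (fun w => x w j 0)) ->
  bounded_adapted G (fun w => grad V (x w) i 0).
Proof.
move=> bx; split; last first.
  by exists b => w; exact: le_trans (coord_le_enorm _ _) (grad_le _).
apply: (@measurable_continuous_comp _ _ (g_sigma_algebraType G) _ x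
  (fun y => grad V y i 0)) => [j|]; first by have [] := bx j.
exact: continuous_grad_coord.
Qed.

Variables (G : set (set Omega)) (x y u a p m : Omega -> 'cV[R]_d).
Variables (gamma c e l beta m2 m3 : R).
Hypothesis G_meas : <<s G >> `<=` measurable.
Hypothesis gamma_ge0 : 0 <= gamma.
Hypothesis c_ge0 : 0 <= c.
Hypothesis x_adapted : forall i, bounded_adapted G (fun w => x w i 0).
Hypothesis p_adapted : forall i, bounded_adapted G (fun w => p w i 0).
Hypothesis u_bounded : forall i, bounded_measurable (fun w => u w i 0).
Hypothesis y_bounded : forall i, bounded_measurable (fun w => y w i 0).
Hypothesis y_step : forall w i,
  y w i 0 = x w i 0 - gamma * (a w i 0 * u w i 0).
Hypothesis a_le : forall w i, 0 <= a w i 0 <= e.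
Hypothesis p_le : forall w i, 0 <= p w i 0 <= e.
Hypothesis p_ge : forall w i, l <= p w i 0.
Hypothesis pa_le : forall w i, `|p w i 0 - a w i 0| <= c * enorm (u w) ^+ 2.
Hypothesis m_cond : forall i,
  is_cond_exp P <<s G >> (fun w => u w i 0) (fun w => m w i 0).
Hypothesis m_bias : {ae P, forall w, enorm (m w - grad V (x w)) <= beta}.
Hypothesis u_mom2 : ('E_P[(fun w => enorm (u w) ^+ 2)%R] <= m2%:E)%E.
Hypothesis u_mom3 : ('E_P[(fun w => enorm (u w) ^+ 3)%R] <= m3%:E)%E.

(** Since [p] and the gradient are known before [u] is drawn, the linear term of
    the descent inequality only sees the conditional expectation [m] of [u],
    which is the gradient up to the bias [beta]. *)
Lemma expected_descent_step :
  \E (fun w => V (y w)) <= \E (fun w => V (x w))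
    - gamma * (l * \E (fun w => enorm (grad V (x w)) ^+ 2) - e * (b * beta))
    + gamma * (c * b * m3) + L / 2 * gamma ^+ 2 * e ^+ 2 * m2.
Proof.
have L0 := lipschitz_constant_ge0.
have e0 : 0 <= e.
  by have /andP[h1 h2] := a_le point (Ordinal d_gt0); exact: le_trans h2.
have bint := @bounded_measurable_integrable _ _ _ P.
have GO f : bounded_adapted G f -> bounded_measurable f.
  exact: bounded_adapted_measurable.
have bg i : bounded_adapted G (fun w => grad V (x w) i 0).
  exact: bounded_adapted_grad_coord.
pose v i w := p w i 0 * grad V (x w) i 0.
have bv i : bounded_adapted G (v i).
  pose F := g_sigma_algebraType G.
  exact: (@bounded_measurableM _ _ F _ _ (p_adapted i) (bg i)).
have intvm i : P.-integrable setT (EFin \o (fun w => v i w * m w i 0)).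
  by apply: integrable_bounded_mul; [exact: GO|have [] := m_cond i].
have bvu i : bounded_measurable (fun w => v i w * u w i 0).
  by apply: bounded_measurableM => //; exact: GO.
have bVx : bounded_measurable (fun w => V (x w)).
  by apply: bounded_measurable_objective => i; exact: GO.
have bu k : bounded_measurable (fun w => enorm (u w) ^+ k).
  by apply: bounded_measurableX; exact: bounded_measurable_enorm.
have bgrad : bounded_measurable (fun w => enorm (grad V (x w)) ^+ 2).
  apply: bounded_measurableX; apply: bounded_measurable_enorm => i.
  exact: GO (bg i).
have EvuE : \E (fun w => \sum_i v i w * u w i 0) =
    \E (fun w => \sum_i v i w * m w i 0).
  rewrite !Rintegral_sum//; last by move=> i; exact: bint.
  apply: eq_bigr => i _; apply: (cond_exp_pull_out (m_cond i) G_meas).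
    exact: GO.
  by move=> r; exact: superlevel_adapted.
have Evm : l * \E (fun w => enorm (grad V (x w)) ^+ 2) - e * (b * beta) <=
    \E (fun w => \sum_i v i w * m w i 0).
  have -> : l * \E (fun w => enorm (grad V (x w)) ^+ 2) - e * (b * beta) =
      \E (fun w => l * enorm (grad V (x w)) ^+ 2 + - (e * (b * beta))).
    rewrite RintegralD//; last exact/bint/bounded_measurable_cst; last first.
      exact/bint/bounded_measurableZ.
    by rewrite RintegralZl//; [rewrite Rintegral_probability_cst|exact: bint].
  apply: ae_le_Rintegral.
  - apply: bint; apply: bounded_measurableD; first exact: bounded_measurableZ.
    exact: bounded_measurable_cst.
  - exact: integrable_real_sum.
  apply: filterS m_bias => w mw.
  apply: weighted_sum_perturbation => // i.
  by have /andP[p0 pe] := p_le w i; rewrite ger0_norm.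
have Em k mk : ('E_P[(fun w => enorm (u w) ^+ k)%R] <= mk%:E)%E ->
    \E (fun w => enorm (u w) ^+ k) <= mk.
  by rewrite (expectation_Rintegral (bint _ (bu k))) lee_fin.
pose lin w := - gamma * (\sum_i v i w * u w i 0).
have bsum : bounded_measurable (fun w => \sum_i v i w * u w i 0).
  exact: bounded_measurable_sum.
have blin : bounded_measurable lin by exact: bounded_measurableZ.
have b1 : bounded_measurable (fun w => V (x w) + lin w).
  exact: bounded_measurableD.
have b2 : bounded_measurable (fun w => gamma * (c * b) * enorm (u w) ^+ 3).
  exact: bounded_measurableZ.
have b3 : bounded_measurable
    (fun w => L / 2 * gamma ^+ 2 * e ^+ 2 * enorm (u w) ^+ 2).
  exact: bounded_measurableZ.
have b12 := bounded_measurableD b1 b2.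
have : \E (fun w => V (y w)) <= \E (fun w => V (x w) + lin w
    + gamma * (c * b) * enorm (u w) ^+ 3
    + L / 2 * gamma ^+ 2 * e ^+ 2 * enorm (u w) ^+ 2).
  apply: le_Rintegral => //.
  - exact/bint/bounded_measurable_objective.
  - exact/bint/(bounded_measurableD b12).
  move=> w _.
  have := descent_step L0 V_diff V_lip gamma_ge0 (grad_le _)
    (y_step w) (a_le w) (pa_le w) d_gt0.
  by rewrite /lin mulNr !mulrA.
rewrite RintegralD//; [|exact: bint b12|exact: bint].
rewrite RintegralD//; [|exact: bint b1|exact: bint].
rewrite RintegralD//; [|exact: bint|exact: bint].
rewrite !RintegralZl//; try exact: bint.
move/le_trans; apply; rewrite EvuE mulNr.
apply: lerD; last first.
  by rewrite ler_wpM2l ?Em// !mulr_ge0 ?sqr_ge0.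
apply: lerD; last first.
  have b0 : 0 <= b by exact: le_trans (enorm_ge0 _) (grad_le 0).
  by rewrite -mulrA ler_wpM2l// ler_wpM2l ?Em// mulr_ge0.
by rewrite lerD2l lerN2 ler_wpM2l.
Qed.

End expected_step.

Theorem theorem3p3 (R : realType) (d q : nat) (hd : (0 < d)%N)
    (* the objective function *)
    (V : 'cV[R]_d -> R) (theta_star : 'cV[R]_d)
    (hmin : forall theta, V theta_star <= V theta)
    (* the state space, the Markov kernels and the fields H_theta *)
    (dE : measure_display) (E : measurableType dE) (iota : E -> q.-tuple R)
    (E_sub : measurable_embedding iota)
    (H : 'cV[R]_d -> E -> 'cV[R]_d)
    (H_meas : forall theta i, measurable_fun setT (fun x => H theta x i 0))
    (Pk : 'cV[R]_d -> R.-pker E ~> E)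
    (pi_ : 'cV[R]_d -> probability E R)
    (pi_inv : forall theta, invariant_law (Pk theta) (pi_ theta))
    (h_grad : forall theta, mean_field H pi_ theta = grad V theta)
    (* the deterministic sequences *)
    (gamma T eps M : nat -> R)
    (gamma_gt0 : forall n, (1 <= n)%N -> 0 < gamma n)
    (T_gt0 : forall n, (1 <= n)%N -> 0 < T n)
    (eps_gt0 : forall n, (1 <= n)%N -> 0 < eps n)
    (* the algorithm *)
    (dO : measure_display) (Omega : measurableType dO) (P : probability Omega R)
    (K : nat -> Omega -> nat) (X : nat -> nat -> Omega -> E)
    (theta0 : 'cV[R]_d) (theta : nat -> Omega -> 'cV[R]_d)
    (K_meas : forall n, (1 <= n)%N -> measurable_fun setT (K n))
    (X_meas : forall n i, (1 <= n)%N -> (1 <= i)%N -> measurable_fun setT (X n i))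
    (* the random vectors H_(theta_n)(X_i^(n+1)) are F_(n+1)-measurable *)
    (HX_meas : forall n i j (B : set R), (1 <= i)%N -> measurable B ->
       history K X n.+1 [set w | B (H (theta n w) (X n.+1 i w) j 0)])
    (K_law : iid_geometric P K)
    (K_indep : forall n,
       independent P (preimage_set_system setT (K n.+1) measurable)
         (history_draws K X n [set i | (1 <= i)%N]))
    (X_markov : forall n,
       markov_given_history K X P (fun w => Pk (theta n w)) n)
    (theta_rec : mlmc_adagrad H eps M gamma T K X theta0 theta)
    (* (i) *)
    (L : R)
    (V_diff : forall x, differentiable V x)
    (V_lip : forall x y, enorm (grad V x - grad V y) <= L * enorm (x - y))
    (* (ii) *)
    (G : R) (G_gt0 : 0 < G)
    (H_bound : forall x, (sup_enorm (H x) <= G%:E)%E)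
    (* (iii), where EH n is any version of E[\hat H^(n+1) | F_n] *)
    (c1 c2 : R)
    (EH : nat -> Omega -> 'cV[R]_d)
    (EH_cond : forall n i, is_cond_exp P (history K X n)
       (fun w => Hhat H T K X theta n w i 0) (fun w => EH n w i 0))
    (H_bias : forall n, {ae P, forall w,
       enorm (EH n w - mean_field H pi_ (theta n w)) <= c1 * G / T n.+1})
    (H_mom2 : forall n,
       ('E_P[(fun w => enorm (Hhat H T K X theta n w) ^+ 2)%R]
        <= (c2 * G ^+ 2 * ln (T n.+1))%:E)%E)
    (* (iv) *)
    (c3 : R)
    (H_mom3 : forall n,
       ('E_P[(fun w => enorm (Hhat H T K X theta n w) ^+ 3)%R]
        <= (c3 * G ^+ 3 * Num.sqrt (T n.+1))%:E)%E)
    (* the horizon and the random index *)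
    (N : nat) (hN : (1 <= N)%N)
    (J : Omega -> nat) (J_meas : measurable_fun setT J)
    (J_law : forall n, (n <= N)%N ->
       P [set w | J w = n]
       = (gamma n.+1 * eps_low eps M n / varpi eps M gamma N)%:E)
    (J_indep : independent P (preimage_set_system setT J measurable)
       (full_history K X)) :
  ('E_P[(fun w => enorm (grad V (theta (J w) w)) ^+ 2)%R] <=
   (2 / varpi eps M gamma N)%:E *
   ('E_P[(fun w => V (theta 0%N w))%R] - (V theta_star)%:E
    + (c1 * G ^+ 2 * \sum_(1 <= n < N.+2) gamma n * (eps n / T n)
       + c3 * G ^+ 4 *
         \sum_(1 <= n < N.+2) gamma n * (eps n ^+ 3 / n%:R) * Num.sqrt (T n)
       + c2 * G ^+ 2 * (L / 2) *
         \sum_(1 <= n < N.+2) gamma n ^+ 2 * eps n ^+ 2 * ln (T n))%:E))%E.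
Proof.
have H_le t x : enorm (H t x) <= G by exact: sup_enorm_le.
have gradE : mean_field H pi_ = grad V by exact/funext.
have grad_le t : enorm (grad V t) <= G.
  by rewrite -h_grad; exact: enorm_mean_field_le.
pose Hh := Hhat H T K X theta.
pose hist n := rounds K X n.
have hist_meas n : <<s hist n >> `<=` measurable by exact: history_measurable.
have theta_adapt n i : bounded_adapted (hist n) (fun w => theta n w i 0).
  exact: (theta_adapted H_le T_gt0 eps_gt0 HX_meas theta_rec).
pose g2 n w := enorm (grad V (theta n w)) ^+ 2.
have g2_adapt n : bounded_adapted (hist n) (g2 n).
  pose F := g_sigma_algebraType (hist n).
  apply: (@bounded_measurableX _ _ F).
  apply: (@bounded_measurable_enorm _ _ F) => i.
  exact: (bounded_adapted_grad_coord hd V_lip grad_le).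
have bint := @bounded_measurable_integrable _ _ _ P.
pose EV n := \int[P]_w V (theta n w).
pose Eg n := \int[P]_w g2 n w.
pose err n := c1 * G ^+ 2 * (gamma n.+1 * (eps n.+1 / T n.+1))
  + c3 * G ^+ 4 * (gamma n.+1 * (eps n.+1 ^+ 3 / n.+1%:R) * Num.sqrt (T n.+1))
  + c2 * G ^+ 2 * (L / 2) * (gamma n.+1 ^+ 2 * eps n.+1 ^+ 2 * ln (T n.+1)).
have step n : gamma n.+1 * eps_low eps M n * Eg n <= EV n - EV n.+1 + err n.
  have Hh_bounded i : bounded_measurable (fun w => Hh n w i 0).
    apply: bounded_adapted_measurable (hist_meas n.+1) _.
    exact: (Hhat_adapted H_le T_gt0 HX_meas).
  have e0 : 0 < eps n.+1 by exact: eps_gt0.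
  have descent : EV n.+1 <= EV n - gamma n.+1 * (eps_low eps M n * Eg n
      - eps n.+1 * (G * (c1 * G / T n.+1)))
      + gamma n.+1 * (eps n.+1 ^+ 3 / n.+1%:R * G
                      * (c3 * G ^+ 3 * Num.sqrt (T n.+1)))
      + L / 2 * gamma n.+1 ^+ 2 * eps n.+1 ^+ 2 * (c2 * G ^+ 2 * ln (T n.+1)).
    apply: (expected_descent_step (u := Hh n) (m := EH n)
      (a := fun w => \col_i step_size eps M Hh n n.+1 i w)
      (p := fun w => \col_i step_size eps M Hh n n i w)
      hd V_diff V_lip hmin grad_le (hist_meas n)) => //.
    - exact/ltW/gamma_gt0.
    - by rewrite divr_ge0// exprn_ge0// ltW.
    - move=> i; under eq_fun do rewrite mxE.
      exact: (step_size_adapted H_le M T_gt0 eps_gt0 HX_meas).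
    - move=> i.
      exact: bounded_adapted_measurable (hist_meas n.+1) (theta_adapt _ _).
    - by move=> w i; rewrite mxE; exact: theta_step theta_rec n w i.
    - by move=> w i; rewrite mxE step_size_ge0 step_size_le.
    - by move=> w i; rewrite mxE step_size_ge0 step_size_le.
    - by move=> w i; rewrite mxE eps_low_le.
    - by move=> w i; rewrite !mxE step_size_predictable.
    - exact: EH_cond.
    - by have := H_bias n; rewrite gradE.
  have -> : err n = gamma n.+1 * (eps n.+1 * (G * (c1 * G / T n.+1)))
      + gamma n.+1 * (eps n.+1 ^+ 3 / n.+1%:R * G
                      * (c3 * G ^+ 3 * Num.sqrt (T n.+1)))
      + L / 2 * gamma n.+1 ^+ 2 * eps n.+1 ^+ 2 * (c2 * G ^+ 2 * ln (T n.+1)).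
    by rewrite /err; move: (T n.+1)^-1 (n.+1%:R^-1) => Ti ni; field.
  move: descent; move: (gamma n.+1 * (_ / _ * G * _)) => cubic.
  move: (L / 2 * _ * _ * _) (eps n.+1 * (G * _)) => quadratic bias; lra.
have EV_ge n : V theta_star <= EV n.
  rewrite -[leLHS](Rintegral_probability_cst P); apply: le_Rintegral => //.
    exact/bint/bounded_measurable_cst.
  apply/bint/(bounded_measurable_objective V_diff V_lip hmin) => i.
  exact: bounded_adapted_measurable (hist_meas n) (theta_adapt n i).
have [theta_init _] := theta_rec.
have V0 : (fun w => V (theta 0 w)) = cst (V theta0).
  by apply/funext => w; rewrite theta_init.
have telescope m : \sum_(0 <= n < m) gamma n.+1 * eps_low eps M n * Eg n <=
    V theta0 - EV m + \sum_(0 <= n < m) err n.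
  elim: m => [|m ih]; last by rewrite !big_nat_recr//=; have := step m; lra.
  by rewrite !big_geq// /EV V0 Rintegral_probability_cst subrr addr0.
pose B := V theta0 - V theta_star + \sum_(0 <= n < N.+1) err n.
have sumB : \sum_(0 <= n < N.+1) gamma n.+1 * eps_low eps M n * Eg n <= B.
  by apply: (le_trans (telescope N.+1)); rewrite /B lerD2r lerB.
have weight_gt0 n : 0 < gamma n.+1 * eps_low eps M n.
  by rewrite mulr_gt0 ?gamma_gt0 ?eps_low_gt0.
have varpi_gt0 : 0 < varpi eps M gamma N.
  rewrite /varpi big_nat_recl//= ltr_pwDl// sumr_ge0// => n _; exact/ltW.
have B_ge0 : 0 <= B.
  apply: le_trans sumB; rewrite sumr_ge0// => n _.
  rewrite mulr_ge0 ?(ltW (weight_gt0 n))// Rintegral_ge0// => w _.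
  by rewrite sqr_ge0.
have g2_full n : bounded_adapted
    (\bigcup_(j in [set j | (1 <= j)%N]) round K X j) (g2 n).
  by apply: bounded_adapted_le (g2_adapt n); exact: history_full.
have full_meas : full_history K X `<=` measurable.
  exact: full_history_measurable.
have g2_le n w : `|g2 n w| <= G ^+ 2.
  by rewrite ger0_norm ?sqr_ge0// lerXn2r ?nnegrE ?enorm_ge0// ltW.
pose p n := gamma n.+1 * eps_low eps M n / varpi eps M gamma N.
have p_sum : \sum_(0 <= n < N.+1) p n = 1.
  by rewrite -mulr_suml divff// gt_eqF.
have EJ := expectation_random_index J_meas J_law p_sum J_indep full_meas g2_full
  g2_le.
have bJ := bounded_random_index J_meas full_meas g2_full g2_le.
rewrite (expectation_Rintegral (bint _ bJ)) V0 expectation_cst.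
rewrite -EFinN -!EFinD -EFinM lee_fin.
have -> : c1 * G ^+ 2 * \sum_(1 <= n < N.+2) gamma n * (eps n / T n)
    + c3 * G ^+ 4 *
      \sum_(1 <= n < N.+2) gamma n * (eps n ^+ 3 / n%:R) * Num.sqrt (T n)
    + c2 * G ^+ 2 * (L / 2) *
      \sum_(1 <= n < N.+2) gamma n ^+ 2 * eps n ^+ 2 * ln (T n)
    = \sum_(0 <= n < N.+1) err n.
  by rewrite !big_add1/= !mulr_sumr -!big_split.
apply: (le_trans EJ).
have -> : \sum_(0 <= n < N.+1) p n * Eg n =
    (varpi eps M gamma N)^-1 *
    \sum_(0 <= n < N.+1) gamma n.+1 * eps_low eps M n * Eg n.
  by rewrite mulr_sumr; apply: eq_bigr => n _; rewrite /p; ring.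
(* [B] bounds a nonnegative sum, so it is at most its double. *)
rewrite -/B -mulrA [leRHS]mulrCA ler_wpM2l ?invr_ge0 ?(ltW varpi_gt0)//.
by rewrite (le_trans sumB)//; lra.
Qed.
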